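(* In the setting of the context, fix $x\in\mathcal X$ (write $\ell_k(z)=\ell_k(x,z)$), $i\in[N]$ and $\lambda\ge0$. Suppose the regularity assumption and the local worst-case oracle assumption hold. Then the algorithm BudgetEval described in the context, run with oracle precision $\epsilon>0$ and golden-section tolerance $\eta>0$, returns $\big(\hat b_i(\lambda),\hat V_i(\hat b_i(\lambda))\big)$ satisfying $$\max_{0\le b\le N\rho}\{V_i(b)-\lambda b\}-\Big(\hat V_i(\hat b_i(\lambda))-\lambda\hat b_i(\lambda)\Big)\le\begin{cases}O\big(\epsilon+\eta^{\min\{1/p,\,1-1/p\}}\big)&\text{if }p>1,\\ O\big(\epsilon+\eta^{1-r}\big)&\text{if }p=1,\end{cases}$$ with the running time complexity of $$\widetilde O\big(K^2\cdot\mathsf{Cost}_\epsilon\cdot\log^3(1/\eta)\big),$$ where $\mathsf{Cost}_{k,\epsilon}\le\mathsf{Cost}_\epsilon$ for all $k\in[K]$.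
   Context: Notation: $[n]=\{1,\dots,n\}$; $\mathcal P(\mathcal Z)$ is the set of Borel probability measures on $\mathcal Z$; $\phi=\frac{\sqrt5-1}2$. In the error bounds, the constants in $O(\cdot)$ depend on the remaining problem data but not on $\epsilon,\eta$; $\widetilde O$ suppresses logarithmic factors. Setting. $\mathcal X\subseteq\mathbb R^n$, $\mathcal Z\subseteq\mathbb R^m$. A transportation cost $c:\mathcal Z\times\mathcal Z\to\mathbb R_+$ is lower semicontinuous, satisfies $c(z,z)=0$ for all $z$, and $c(\cdot,\hat z)$ is convex for every fixed $\hat z\in\mathcal Z$. The optimal transport discrepancy is $\mathrm{OT}_c(\mathbb P,\mathbb Q)=\min_{\gamma}\mathbb E_{(z,\hat z)\sim\gamma}[c(z,\hat z)]$ over couplings $\gamma$ of $\mathbb P$ and $\mathbb Q$. Given $\hat z_1,\dots,\hat z_N\in\mathcal Z$, let $\hat{\mathbb P}=\frac1N\sum_{i=1}^N\delta_{\hat z_i}$; given $\rho>0$, let $\mathcal P=\{\mathbb P\in\mathcal P(\mathcal Z):\mathrm{OT}_c(\mathbb P,\hat{\mathbb P})\le\rho\}$. Regularity assumption. (i) $\mathcal X$ is nonempty and convex; there exist $\mathbb Q_0\in\mathcal P$ and $x_0\in\mathcal X$ such that $x\mapsto\mathbb E_{z\sim\mathbb Q_0}[\ell(x,z)]$ is inf-compact on $\mathcal X$ (all sublevel sets are compact) and $\mathbb E_{z\sim\mathbb Q_0}[\ell(x_0,z)]>-\infty$; $\mathcal Z$ is nonempty, closed and convex. (ii) $\ell(x,z)=\max_{k\in[K]}\ell_k(x,z)$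 with $K\ge2$, where each $\ell_k:\mathbb R^n\times\mathbb R^m\to\mathbb R$ is real-valued, convex in its first and concave in its second argument. (iii) There exist a norm $\|\cdot\|$ on $\mathbb R^m$ and $p\ge1$ with $c(z,\hat z)\ge\|z-\hat z\|^p$ for all $z,\hat z\in\mathcal Z$; moreover, if $p=1$, then for every $x\in\mathcal X$ there exist $g>0$, $\hat z_0\in\mathcal Z$ and $r\in[0,1)$ such that $\ell(x,z)\le g[1+\|z-\hat z_0\|^r]$. Local worst-case oracle assumption. For any $k\in[K]$, $\hat z\in\mathcal Z$, radius $u\ge0$ and accuracy $\epsilon>0$ there is an algorithm, denoted $(\hat L,\hat v)\gets\mathsf{WCO}_k^\epsilon(\hat z,u)$, running in time $\mathsf{Cost}_{k,\epsilon}$ that returns $\hat v\in\mathbb R^m$ with $\hat z+\hat v\in\mathcal Z$, $c(\hat z+\hat v,\hat z)\le u$, together with $\hat L=\ell_k(\hat z+\hat v)$ satisfying $\hat L\ge\max\{\ell_k(\hat z+v):v\in\mathbb R^m,\hat z+v\in\mathcal Z,c(\hat z+v,\hat z)\le u\}-\epsilon$. Local utilities. For $b\ge0$: $V_i(b)=\max_{1\le k_1<k_2\le K}V_i^{(k_1,k_2)}(b)$, where $V_i^{(k_1,k_2)}(b)$ is the maximum of $\alpha_1\ell_{k_1}(\hat z_i+v_1)+\alpha_2\ell_{k_2}(\hat z_i+v_2)$ over $\alpha_j,\beta_j\in\mathbb R_+$, $v_j\in\mathbb R^m$ with $\hat z_i+v_j\in\mathcal Z$, $\alpha_jc(\hat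 z_i+v_j,\hat z_i)\le\beta_j$ ($j=1,2$), $\alpha_1+\alpha_2=1$, $\beta_1+\beta_2=b$. Algorithms (all use the same $\eta,\epsilon$). InnerSolver$(i,k_1,k_2,b,\alpha_1)$ with $\alpha_1\in(0,1)$: set $\alpha_2=1-\alpha_1$, $L=0$, $U=b$, $\beta^{(1)}=U-\phi(U-L)$, $\beta^{(2)}=L+\phi(U-L)$. While $U-L>\eta$: for $j=1,2$ call $(L_1^{(j)},v_1^{(j)})\gets\mathsf{WCO}^\epsilon_{k_1}(\hat z_i,\beta^{(j)}/\alpha_1)$, $(L_2^{(j)},v_2^{(j)})\gets\mathsf{WCO}^\epsilon_{k_2}(\hat z_i,(b-\beta^{(j)})/\alpha_2)$ and set $V^{(j)}=\alpha_1L_1^{(j)}+\alpha_2L_2^{(j)}$; if $V^{(1)}<V^{(2)}$, set $L\gets\beta^{(1)}$, $\beta^{(1)}\gets\beta^{(2)}$, $\beta^{(2)}\gets L+\phi(U-L)$; otherwise set $U\gets\beta^{(2)}$, $\beta^{(2)}\gets\beta^{(1)}$, $\beta^{(1)}\gets U-\phi(U-L)$. Finally choose $j^\star\in\arg\max_jV^{(j)}$ and return the value $V^{(j^\star)}$ and the optimizer $(\alpha_1,\alpha_2,\beta^{(j^\star)},b-\beta^{(j^\star)},v_1^{(j^\star)},v_2^{(j^\star)})$, where $\beta^{(j^\star)}$ is the point at which $V^{(j^\star)}$ was evaluated. PairEval$(i,k_1,k_2,b)$: the same golden-section search over $\alpha\in[0,1]$ (start $L=0$, $U=1$, $\alpha^{(1)}=U-\phi(U-L)$,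 $\alpha^{(2)}=L+\phi(U-L)$, stop when $U-L\le\eta$, same interval updates), where the value $V^{(j)}$ and optimizer $s^{(j)}$ at $\alpha^{(j)}$ are those returned by InnerSolver$(i,k_1,k_2,b,\alpha^{(j)})$; return the larger of the two final values $V^{(j)}$ and its optimizer. LocalEval$(i,b)$: run PairEval$(i,k_1,k_2,b)$ for all $1\le k_1<k_2\le K$ and return the largest value, denoted $\hat V_i(b)$, its optimizer and the pair attaining it. BudgetEval$(i,\lambda)$: set $L=0$, $U=N\rho$, $b^{(1)}=U-\phi(U-L)$, $b^{(2)}=L+\phi(U-L)$, and let $\hat V^{(j)}$ be the value from LocalEval$(i,b^{(j)})$, $j=1,2$. While $U-L>\eta$: if $\hat V^{(1)}-\lambda b^{(1)}<\hat V^{(2)}-\lambda b^{(2)}$, set $L\gets b^{(1)}$, $b^{(1)}\gets b^{(2)}$ (carrying its value along), $b^{(2)}\gets L+\phi(U-L)$ and let $\hat V^{(2)}$ be the value from LocalEval$(i,b^{(2)})$; otherwise set $U\gets b^{(2)}$, $b^{(2)}\gets b^{(1)}$ (carrying its value along), $b^{(1)}\gets U-\phi(U-L)$ and let $\hat V^{(1)}$ be the value from LocalEval$(i,b^{(1)})$. Finally set $\hat b_i(\lambda)=L$ and return it together with the output of LocalEval$(i,\hat b_i(\lambda))$, in particular $\hat V_i(\hat b_i(\lambda))$. *)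

(* Defs.v *)
From HB Require Import structures.
From mathcomp Require Import all_boot all_order all_algebra.
From mathcomp Require Import all_classical all_reals all_analysis.

Set Implicit Arguments.
Unset Strict Implicit.
Unset Printing Implicit Defensive.

Import Order.TTheory GRing.Theory Num.Theory.
Import numFieldNormedType.Exports.

Local Open Scope classical_set_scope.
Local Open Scope ring_scope.

Section Setting.
Context (R : realType) (n m K N : nat).

Definition borel : measurableType _ := g_sigma_algebraType (@open 'rV[R]_m).

Definition is_norm (nrm : 'rV[R]_m -> R) : Prop :=
  [/\ forall v, 0 <= nrm v,
      forall v, nrm v = 0 -> v = 0,
      forall (a : R) v, nrm (a *: v) = `|a| * nrm v
    & forall v w, nrm (v + w) <= nrm v + nrm w].

(* The cost is a total function on R^m x R^m of which only the values on
   Z x Z matter. Its lower semicontinuity is relative to Z x Z: in the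
   [subspace] topology the points outside Z x Z are isolated. *)
Record transport_cost (Z : set 'rV[R]_m) (c : 'rV[R]_m -> 'rV[R]_m -> R) :
    Prop := TransportCost {
  cost_ge0 : forall z zh, Z z -> Z zh -> 0 <= c z zh ;
  cost_lsc : @lower_semicontinuous (subspace (Z `*` Z)) R
               (fun q : 'rV[R]_m * 'rV[R]_m => (c q.1 q.2)%:E) ;
  cost_diag : forall z, Z z -> c z z = 0 ;
  cost_convex : forall zh, Z zh -> @convex_function R 'rV[R]_m Z (c^~ zh) }.

Definition coupling (P Q : set borel -> \bar R)
    (g : probability (borel * borel)%type R) : Prop :=
  forall A : set borel, measurable A ->
    g (A `*` setT) = P A /\ g (setT `*` A) = Q A.

(* The marginals below are carried by Z, hence so is every coupling by Z x Z. *)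
Definition OT (Z : set 'rV[R]_m) (c : 'rV[R]_m -> 'rV[R]_m -> R)
    (P Q : set borel -> \bar R) : \bar R :=
  ereal_inf [set (\int[g]_(q in (Z `*` Z : set (borel * borel)))
                    (c q.1 q.2)%:E)%E
            | g in coupling P Q].

Definition empirical (zhat : 'I_N -> 'rV[R]_m) (A : set borel) : \bar R :=
  ((N%:R^-1)%:E * \sum_(i < N) (\d_(zhat i : borel) A))%E.

Definition ambiguity_set (Z : set 'rV[R]_m) (c : 'rV[R]_m -> 'rV[R]_m -> R)
    (zhat : 'I_N -> 'rV[R]_m) (rho : R) : set (probability borel R) :=
  [set P | P (Z : set borel) = 1%E /\ (OT Z c P (empirical zhat) <= rho%:E)%E].

(* A maximum of K >= 2 numbers, written as a supremum. *)
Definition loss (ell : 'I_K -> 'rV[R]_n -> 'rV[R]_m -> R)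
    (x : 'rV[R]_n) (z : 'rV[R]_m) : R :=
  sup [set ell k x z | k in [set: 'I_K]].

Definition expected_loss (Z : set 'rV[R]_m)
    (ell : 'I_K -> 'rV[R]_n -> 'rV[R]_m -> R)
    (Q : probability borel R) (x : 'rV[R]_n) : \bar R :=
  (\int[Q]_(z in (Z : set borel)) (loss ell x z)%:E)%E.

Definition growth (Z : set 'rV[R]_m)
    (ell : 'I_K -> 'rV[R]_n -> 'rV[R]_m -> R) (nrm : 'rV[R]_m -> R)
    (x : 'rV[R]_n) (g : R) (zh0 : 'rV[R]_m) (r : R) : Prop :=
  [/\ 0 < g, Z zh0, 0 <= r < 1
    & forall z, Z z -> loss ell x z <= g * (1 + nrm (z - zh0) `^ r)].

Record regularity (X : set 'rV[R]_n) (Z : set 'rV[R]_m)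
    (c : 'rV[R]_m -> 'rV[R]_m -> R)
    (ell : 'I_K -> 'rV[R]_n -> 'rV[R]_m -> R)
    (zhat : 'I_N -> 'rV[R]_m) (rho : R) (nrm : 'rV[R]_m -> R) (p : R) :
    Prop := Regularity {
  reg_X : X !=set0 /\ @convex_set R 'rV[R]_n X ;
  reg_inf_compact : exists (Q0 : probability borel R) (x0 : 'rV[R]_n),
    [/\ ambiguity_set Z c zhat rho Q0, X x0,
        forall a : R, compact (X `&`
          [set x | (expected_loss Z ell Q0 x <= a%:E)%E])
      & (-oo < expected_loss Z ell Q0 x0)%E] ;
  reg_Z : [/\ Z !=set0, closed Z & @convex_set R 'rV[R]_m Z] ;
  reg_K : (2 <= K)%N ;
  reg_convex : forall k z, @convex_function R 'rV[R]_n setT (ell k ^~ z) ;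
  reg_concave : forall k x,
    @convex_function R 'rV[R]_m setT (fun z => - ell k x z) ;
  reg_norm : is_norm nrm ;
  reg_p : 1 <= p ;
  reg_cost : forall z zh, Z z -> Z zh -> nrm (z - zh) `^ p <= c z zh ;
  reg_growth : p = 1 -> forall x, X x -> exists g zh0 r,
    growth Z ell nrm x g zh0 r }.

(* For p = 1 every r admitted by the growth condition at x is covered. *)
Definition error_exponent (Z : set 'rV[R]_m)
    (ell : 'I_K -> 'rV[R]_n -> 'rV[R]_m -> R) (nrm : 'rV[R]_m -> R) (p : R)
    (x : 'rV[R]_n) (a : R) : Prop :=
  (1 < p /\ a = Num.min p^-1 (1 - p^-1)) \/
  (p = 1 /\ exists g zh0 r, growth Z ell nrm x g zh0 r /\ a = 1 - r).

End Setting.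

Section Local.
Context (R : realType) (m K N : nat).
Variables (Z : set 'rV[R]_m) (c : 'rV[R]_m -> 'rV[R]_m -> R)
  (lk : 'I_K -> 'rV[R]_m -> R). (* lk k z = l_k(x, z) with x fixed *)

(* [WCO eps k zh u] is the value and displacement ((L, v), t) returned by the
   call, together with the number t of time units it takes. *)
Definition oracle := R -> 'I_K -> 'rV[R]_m -> R -> (R * 'rV[R]_m) * nat.

Definition worst_case (k : 'I_K) (zh : 'rV[R]_m) (u : R) : \bar R :=
  ereal_sup [set (lk k (zh + v))%:E
            | v in [set v | Z (zh + v) /\ c (zh + v) zh <= u]].

(* A call takes at least one time unit. *)
Definition oracle_assumption (WCO : oracle) (Cost : 'I_K -> R -> nat) : Prop :=
  forall (eps : R) (k : 'I_K) (zh : 'rV[R]_m) (u : R),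
    0 < eps -> Z zh -> 0 <= u ->
    let: ((L, v), t) := WCO eps k zh u in
    [/\ Z (zh + v), c (zh + v) zh <= u, L = lk k (zh + v),
        (worst_case k zh u - eps%:E <= L%:E)%E
      & (0 < t <= Cost k eps)%N].

Definition pair_utility (zh : 'rV[R]_m) (k1 k2 : 'I_K) (b : R) : \bar R :=
  ereal_sup [set V | exists (a1 a2 b1 b2 : R) (v1 v2 : 'rV[R]_m),
    [/\ [/\ 0 <= a1, 0 <= a2, 0 <= b1 & 0 <= b2],
        Z (zh + v1) /\ Z (zh + v2),
        a1 * c (zh + v1) zh <= b1 /\ a2 * c (zh + v2) zh <= b2,
        a1 + a2 = 1 /\ b1 + b2 = b
      & V = (a1 * lk k1 (zh + v1) + a2 * lk k2 (zh + v2))%:E]].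

Definition utility (zh : 'rV[R]_m) (b : R) : \bar R :=
  ereal_sup [set pair_utility zh k.1 k.2 b
            | k in [set k : 'I_K * 'I_K | (k.1 < k.2)%N]].

End Local.

Section Timed.

(* [None] is divergence, [Some (a, t)] is the result [a] after [t] units. *)
Definition timed (A : Type) := option (A * nat).

Definition ret {A} (a : A) : timed A := Some (a, 0%N).
Definition tick : timed unit := Some (tt, 1%N).
Definition bind {A B} (e : timed A) (f : A -> timed B) : timed B :=
  if e is Some (a, t) then
    if f a is Some (b, t') then Some (b, (t + t')%N) else None
  else None.

Fixpoint while_fuel {S} (fuel : nat) (cond : S -> bool) (body : S -> timed S)
    (s : S) : timed S :=
  if fuel is fuel'.+1 then
    if cond s then bind (body s) (while_fuel fuel' cond body) else ret s
  else None.

(* [None] exactly when no number of iterations suffices. *)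
Definition while {S} (cond : S -> bool) (body : S -> timed S) (s : S) : timed S :=
  match pselect (exists fuel, isSome (while_fuel fuel cond body s)) with
  | left terminates => while_fuel (ex_minn terminates) cond body s
  | right _ => None
  end.

End Timed.

Notation "'let*' x := e1 'in' e2" := (bind e1 (fun x => e2))
  (at level 200, x name, e1 at level 200, e2 at level 200).

(* Every oracle call is charged its own time; one further unit is charged for
   each initialisation of a search, each loop iteration and each pair visited
   by [local_eval], to cover the bounded number of elementary operations
   (arithmetic, comparisons, assignments) performed there. *)

Section Golden.
Context (R : realType) (S : Type).
Variables (eta : R) (eval : R -> timed (R * S)).

Definition phi : R := (Num.sqrt 5 - 1) / 2.

(* [g_last] holds the results of the two most recent evaluations. They were
   made at the probes in force before the last interval update. *)
Record gstate := GState {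
  g_lo : R ; g_hi : R ; g_1 : R ; g_2 : R ;
  g_last : option ((R * S) * (R * S)) }.

Definition golden_init (L U : R) : gstate :=
  GState L U (U - phi * (U - L)) (L + phi * (U - L)) None.

Definition golden_eval2 (s : gstate) : timed ((R * S) * (R * S)) :=
  let* e1 := eval (g_1 s) in
  let* e2 := eval (g_2 s) in
  ret (e1, e2).

Definition golden_step (s : gstate) : timed gstate :=
  let* e := golden_eval2 s in
  let* _ := tick in
  ret (if e.1.1 < e.2.1 then
         let L := g_1 s in let U := g_hi s in
         GState L U (g_2 s) (L + phi * (U - L)) (Some e)
       else
         let L := g_lo s in let U := g_2 s in
         GState L U (U - phi * (U - L)) (g_1 s) (Some e)).

(* If U - L <= eta from the start, no value has been computed in the loop; the
   two initial probes are then evaluated. *)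
Definition golden (L U : R) : timed (R * S) :=
  let* _ := tick in
  let* s := while (fun s => eta < g_hi s - g_lo s) golden_step
                  (golden_init L U) in
  let* e := if g_last s is Some e then ret e else golden_eval2 s in
  ret (if e.1.1 < e.2.1 then e.2 else e.1).

End Golden.

Section Algorithms.
Context (R : realType) (m K N : nat).
Variables (zhat : 'I_N -> 'rV[R]_m) (rho : R) (WCO : oracle R m K)
  (eps eta : R) (i : 'I_N).

Record optimizer := Optimizer {
  opt_alpha1 : R ; opt_alpha2 : R ; opt_beta1 : R ; opt_beta2 : R ;
  opt_v1 : 'rV[R]_m ; opt_v2 : 'rV[R]_m }.

Definition call_oracle (k : 'I_K) (u : R) : timed (R * 'rV[R]_m) :=
  Some (WCO eps k (zhat i) u).

Definition inner_solver (k1 k2 : 'I_K) (b alpha1 : R) : timed (R * optimizer) :=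
  let alpha2 := 1 - alpha1 in
  golden eta (fun beta =>
    let* r1 := call_oracle k1 (beta / alpha1) in
    let* r2 := call_oracle k2 ((b - beta) / alpha2) in
    ret (alpha1 * r1.1 + alpha2 * r2.1,
         Optimizer alpha1 alpha2 beta (b - beta) r1.2 r2.2)) 0 b.

Definition pair_eval (k1 k2 : 'I_K) (b : R) : timed (R * optimizer) :=
  golden eta (inner_solver k1 k2 b) 0 1.

Definition local_output : Type := (R * optimizer) * ('I_K * 'I_K).

Fixpoint best_pair (b : R) (ks : seq ('I_K * 'I_K))
    (best : option local_output) : timed local_output :=
  if ks is k :: ks' then
    let* e := pair_eval k.1 k.2 b in
    let* _ := tick in
    best_pair b ks'
      (if best is Some o then
         if o.1.1 < e.1 then Some (e, k) else Some o
       else Some (e, k))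
  else if best is Some o then ret o else None.

Definition local_eval (b : R) : timed local_output :=
  best_pair b [seq k : 'I_K * 'I_K <- enum {: 'I_K * 'I_K} | (k.1 < k.2)%N] None.

Record bstate := BState {
  b_lo : R ; b_hi : R ; b_1 : R ; b_2 : R ; b_V1 : R ; b_V2 : R }.

Definition budget_step (lambda : R) (s : bstate) : timed bstate :=
  let* _ := tick in
  if b_V1 s - lambda * b_1 s < b_V2 s - lambda * b_2 s then
    let L := b_1 s in let U := b_hi s in
    let b2 := L + phi R * (U - L) in
    let* o := local_eval b2 in
    ret (BState L U (b_2 s) b2 (b_V2 s) o.1.1)
  else
    let L := b_lo s in let U := b_2 s in
    let b1 := U - phi R * (U - L) in
    let* o := local_eval b1 in
    ret (BState L U b1 (b_1 s) o.1.1 (b_V1 s)).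

Definition budget_eval (lambda : R) : timed (R * local_output) :=
  let L := 0 in let U := N%:R * rho in
  let b1 := U - phi R * (U - L) in
  let b2 := L + phi R * (U - L) in
  let* _ := tick in
  let* o1 := local_eval b1 in
  let* o2 := local_eval b2 in
  let* s := while (fun s => eta < b_hi s - b_lo s) (budget_step lambda)
                  (BState L U b1 b2 o1.1.1 o2.1.1) in
  let* o := local_eval (b_lo s) in
  ret (b_lo s, o).

End Algorithms.

(* Main.v *)
Require Import Defs.
From mathcomp Require Import all_boot all_order all_algebra.
From mathcomp Require Import ring lra zify.
From mathcomp Require Import all_classical all_reals all_analysis.
Import Order.TTheory GRing.Theory Num.Theory.
Import numFieldNormedType.Exports.
Local Open Scope classical_set_scope.
Local Open Scope ring_scope.

Set Implicit Arguments.
Unset Strict Implicit.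
Unset Printing Implicit Defensive.

(** The values [h_k u] of the local worst-case problems are concave and
    nondecreasing in the radius [u], and every utility is a supremum of sums of
    perspectives [a * h_k (b / a)], hence concave in the weight and in the budget.
    A golden-section search on a concave function, with probes evaluated up to
    [delta] from below, keeps the better probe, so the value of the kept probe
    never decreases: discarding the maximiser loses at most [3 delta], however many
    comparisons are wrong, and no logarithmic factor appears.  The remaining error
    is the modulus of continuity at scale [eta]: [b^(1/p)] in the budget, since
    concave losses grow at most linearly and the cost dominates [|.|^p], and
    [a * (b / a)^(1/p)], i.e. the exponent [1 - 1/p], in the weight.  The maximum
    of the pair utilities is again concave, because on the line two points suffice
    for a concave envelope. *)

(** * Golden-section search *)

(** Oracle values are attained at feasible points, so every computed value errs only from below. One
    search with evaluation error [delta] and modulus [omega] has error [3 * delta + omega]; with e =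
    eta^a this turns [eps] into 3 eps + C e for the budget split and 9 eps + 5 C e for the weight.
    The outermost search ends at 36 eps + 24 C e, because it returns an end point instead of its
    best probe. The delicate variable is the weight: as it tends to 0 the radius beta / alpha
    explodes, so continuity of the profiles must be complemented by a bound on their growth at
    infinity. For p = 1 the generic linear growth would give exponent 0, which is why growth of
    order r < 1 is assumed there. All constants come from the value of the profiles at 0 and their
    growth, and are fixed before the oracle, eps and eta. *)

Section GoldenRatio.
Context (R : realType).
Local Notation phi := (phi R).

Lemma phi_bounds : 3 / 5 < phi < 2 / 3.
Proof.
have s0 := sqrtr_ge0 (5 : R).
have s2 : Num.sqrt (5 : R) ^+ 2 = 5 by rewrite sqr_sqrtr// ler0n.
rewrite /Defs.phi; apply/andP; split; nra.
Qed.

Lemma phi_sqr : phi ^+ 2 = 1 - phi.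
Proof.
have s2 : Num.sqrt (5 : R) ^+ 2 = 5 by rewrite sqr_sqrtr// ler0n.
by rewrite /Defs.phi; lra.
Qed.

Lemma phi_ge0 : 0 <= phi.
Proof. by have /andP[] := phi_bounds; lra. Qed.

Lemma probes_lt (lo hi : R) : lo < hi ->
  [/\ lo < hi - phi * (hi - lo), hi - phi * (hi - lo) < lo + phi * (hi - lo) &
      lo + phi * (hi - lo) < hi].
Proof. by have /andP[p1 p2] := phi_bounds => lh; split; nra. Qed.

Lemma probes_le (lo hi : R) : lo <= hi ->
  lo <= hi - phi * (hi - lo) <= hi /\ lo <= lo + phi * (hi - lo) <= hi.
Proof.
by have /andP[p1 p2] := phi_bounds => lh; split; apply/andP; split; nra.
Qed.

(** By phi^2 = 1 - phi, the probe that survives an update is exactly a probe of the shorter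
    interval, so its value stays valid there. *)
Lemma probe_left (lo hi : R) :
  lo + phi * (hi - lo) = hi - phi * (hi - (hi - phi * (hi - lo))).
Proof. by rewrite subKr mulrA -expr2 phi_sqr; ring. Qed.

Lemma probe_right (lo hi : R) :
  hi - phi * (hi - lo) = lo + phi * (lo + phi * (hi - lo) - lo).
Proof. by rewrite [lo + phi * (hi - lo) - lo]addrAC subrr add0r mulrA -expr2 phi_sqr; ring. Qed.

End GoldenRatio.

(** * Termination and cost of loops that contract a width *)

Section WhileRule.
Context (S : Type).
Implicit Types (cond : S -> bool) (body : S -> timed S).

Lemma while_fuelS fuel cond body s r :
  while_fuel fuel cond body s = Some r -> while_fuel fuel.+1 cond body s = Some r.
Proof.
elim: fuel s r => [//|fuel IH] s r.
rewrite [in X in X -> _]/=; rewrite [while_fuel fuel.+2 _ _ _]/=.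
case: (cond s) => //.
case: (body s) => [[s' t]|] //=.
case E: (while_fuel fuel cond body s') => [q|] //.
by have /= -> := IH _ _ E.
Qed.

Lemma while_fuel_leq fuel fuel' cond body s r : (fuel <= fuel')%N ->
  while_fuel fuel cond body s = Some r -> while_fuel fuel' cond body s = Some r.
Proof.
move=> /subnK <-; elim: (fuel' - fuel)%N => [//|n IH] /IH.
exact: while_fuelS.
Qed.

(** Extra fuel does not change a result, so the minimal fuel chosen by [while] agrees with any
    sufficient one. *)
Lemma while_fuelE fuel cond body s r :
  while_fuel fuel cond body s = Some r -> while cond body s = Some r.
Proof.
move=> E; rewrite /while; case: pselect => [ex|[]]; last first.
  by exists fuel; rewrite E.
case: ex_minnP => k; case Ek: (while_fuel k cond body s) => [r'|] // _ mink.
have /mink kf : isSome (while_fuel fuel cond body s) by rewrite E.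
by have := while_fuel_leq kf Ek; rewrite E => <-.
Qed.

Lemma while_contract (R : realType) (width : S -> R) (eta q : R) body
    (Inv : S -> Prop) (T : nat) :
  0 <= q ->
  (forall s, Inv s -> eta < width s -> exists s' t,
     [/\ body s = Some (s', t), (t <= T)%N, Inv s' & width s' = q * width s]) ->
  forall n s, Inv s -> width s * q ^+ n <= eta ->
  exists s' t, [/\ while (fun s => eta < width s) body s = Some (s', t),
    (t <= n * T)%N, Inv s' & width s' <= eta].
Proof.
move=> q0 step n s Is wn.
(* Fuel [n.+1] for [n] iterations: the failing test that leaves the loop consumes a unit too. *)
suff [s' [t [E tT Is' ws']]] : exists s' t,
    [/\ while_fuel n.+1 (fun s => eta < width s) body s = Some (s', t),
    (t <= n * T)%N, Inv s' & width s' <= eta].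
  by exists s', t; split => //; apply: while_fuelE E.
elim: n s Is wn => [|n IH] s Is wn.
  move: wn; rewrite expr0 mulr1 => wn; exists s, 0%N => /=.
  by rewrite ltNge wn.
rewrite [while_fuel _ _ _ _]/=.
have [lt|le] := ltP eta (width s); last first.
  by exists s, 0%N.
have [s1 [t1 [-> t1T Is1 w1]]] := step _ Is lt.
have [|s2 [t2 [E2 t2T Is2 w2]]] := IH _ Is1.
  by rewrite w1 (_ : _ * _ = width s * q ^+ n.+1)// exprS; ring.
exists s2, (t1 + t2)%N; split => //; last by rewrite mulSn leq_add.
by move: E2 => /= ->.
Qed.

End WhileRule.

(** Jensen's inequality for three points, with the denominators cleared. *)
Definition concave_on (R : realType) (L U : R) (f : R -> R) :=
  forall x y z, L <= x -> x < y -> y < z -> z <= U ->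
    (z - y) * f x + (y - x) * f z <= (z - x) * f y.

Section Discard.
Context (R : realType).
Variables (L0 U0 : R) (f : R -> R).
Hypothesis fconc : concave_on L0 U0 f.

(* The probes cut the interval in the proportions phi^2 : phi^3 : phi^2, so
   dropping an end segment costs at most delta / phi. *)
Lemma discard_left (L U delta x : R) : L0 <= L -> L < U -> U <= U0 -> 0 <= delta ->
  let b1 := U - phi R * (U - L) in let b2 := L + phi R * (U - L) in
  f b1 <= f b2 + delta -> L <= x -> x <= b1 -> f x <= f b1 + 2 * delta.
Proof.
move=> L0L LU UU0 d0 b1 b2 fb Lx; rewrite le_eqVlt => /predU1P[->|xb1]; first lra.
have /andP[p1 p2] := phi_bounds R.
have w0 : 0 < U - L by lra.
have b12 : b1 < b2 by rewrite /b1 /b2; nra.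
have b2U : b2 <= U0 by rewrite /b2; nra.
have L0x : L0 <= x by lra.
have := fconc L0x xb1 b12 b2U.
have d1 : b1 - x <= 2 * (b2 - b1) by rewrite /b2 /b1; nra.
move=> H.
have H2 : (b2 - b1) * (f x - f b1) <= (b1 - x) * (f b1 - f b2) by lra.
have : (b1 - x) * (f b1 - f b2) <= (b1 - x) * delta.
  by rewrite ler_wpM2l; lra.
have : (b1 - x) * delta <= 2 * (b2 - b1) * delta by rewrite ler_wpM2r.
move=> h3 h4; have : (b2 - b1) * (f x - f b1) <= (b2 - b1) * (2 * delta) by lra.
by rewrite ler_pM2l; lra.
Qed.

End Discard.

(** Mirror image of [discard_left]: the reflection y -> -y preserves concavity and exchanges the
    probes. *)
Lemma discard_right (R : realType) (L0 U0 : R) (f : R -> R) (L U delta x : R) :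
  concave_on L0 U0 f -> L0 <= L -> L < U -> U <= U0 -> 0 <= delta ->
  let b1 := U - phi R * (U - L) in let b2 := L + phi R * (U - L) in
  f b2 <= f b1 + delta -> b2 <= x -> x <= U -> f x <= f b2 + 2 * delta.
Proof.
move=> fconc L0L LU UU0 d0 b1 b2 fb b2x xU.
pose g y := f (- y).
have gconc : concave_on (- U0) (- L0) g.
  move=> u v w h1 h2 h3 h4; rewrite /g.
  have := @fconc (- w) (- v) (- u) ltac:(lra) ltac:(lra) ltac:(lra) ltac:(lra).
  lra.
have := @discard_left _ _ _ g gconc (- U) (- L) delta (- x).
have -> : - L - phi R * (- L - - U) = - b2 by rewrite /b2; ring.
have -> : - U + phi R * (- L - - U) = - b1 by rewrite /b1; ring.
rewrite /g !opprK; apply; lra.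
Qed.

Section Bracket.
Context (R : realType).
Variables (L0 U0 delta : R) (f : R -> R).
Hypotheses (fconc : concave_on L0 U0 f) (delta0 : 0 <= delta).

(* M is the value of the best probe seen so far; it never decreases. This is
   what keeps the errors of successive wrong comparisons from adding up. *)
Definition bracket (lo hi M : R) : Prop :=
  [/\ L0 <= lo, lo <= hi, hi <= U0 &
      forall x, L0 <= x <= U0 -> lo <= x <= hi \/ f x <= M + 3 * delta].

(** The 3 delta in [bracket] arise here: 2 delta from [discard_left], and one more because [v1] may
    undershoot [f b1]. *)
Lemma bracket_left (lo hi M M' v1 v2 : R) :
  let b1 := hi - phi R * (hi - lo) in let b2 := lo + phi R * (hi - lo) in
  lo < hi -> bracket lo hi M -> M <= M' -> v1 <= M' -> v1 <= v2 ->
  f b1 - delta <= v1 -> v2 <= f b2 -> bracket b1 hi M'.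
Proof.
move=> b1 b2 lohi [L0lo _ hiU0 Hx] MM' v1M v12 fb1 fb2.
have /andP[p1 p2] := phi_bounds R.
have lb1 : lo <= b1 by rewrite /b1; nra.
have b1h : b1 <= hi by rewrite /b1; nra.
split => //; first exact: le_trans lb1.
move=> x /[dup] xI /Hx [/andP[lox xhi]|]; last by lra.
have [b1x|xb1] := leP b1 x; first by left; apply/andP; split.
right; have := @discard_left _ _ _ _ fconc lo hi delta x L0lo lohi hiU0 delta0.
by rewrite -/b1 -/b2 => /(_ ltac:(lra) lox (ltW xb1)); lra.
Qed.

Lemma bracket_right (lo hi M M' v1 v2 : R) :
  let b1 := hi - phi R * (hi - lo) in let b2 := lo + phi R * (hi - lo) in
  lo < hi -> bracket lo hi M -> M <= M' -> v2 <= M' -> v2 <= v1 ->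
  f b2 - delta <= v2 -> v1 <= f b1 -> bracket lo b2 M'.
Proof.
move=> b1 b2 lohi [L0lo _ hiU0 Hx] MM' v1M v12 fb1 fb2.
have /andP[p1 p2] := phi_bounds R.
have lb1 : lo <= b2 by rewrite /b2; nra.
have b1h : b2 <= hi by rewrite /b2; nra.
split => //; first exact: le_trans hiU0.
move=> x /[dup] xI /Hx [/andP[lox xhi]|]; last by lra.
have [xb2|b2x] := leP x b2; first by left; apply/andP; split.
right; have := @discard_right _ _ _ _ lo hi delta x fconc L0lo lohi hiU0 delta0.
by rewrite -/b1 -/b2 => /(_ ltac:(lra) (ltW b2x) xhi); lra.
Qed.

Lemma bracket_init M : L0 <= U0 -> bracket L0 U0 M.
Proof. by move=> LU; split => // x xI; left. Qed.

(** A discarded point is within 3 delta of [M]; a surviving one is compared with [q] through the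
    modulus. *)
Lemma bracket_final (omega lo hi M v q : R) :
  (forall x, lo <= x <= hi -> f x - f q <= omega) ->
  bracket lo hi M -> lo <= q <= hi -> M <= v -> f q - delta <= v ->
  forall x, L0 <= x <= U0 -> f x - v <= 3 * delta + omega.
Proof.
move=> mod [L0lo lohi hiU0 Hx] qI Mv fq x xI; have d0 := delta0.
have w0 : 0 <= omega by have := mod q qI; rewrite subrr.
by have [/mod|] := Hx _ xI; lra.
Qed.

End Bracket.

Lemma golden_time (n T t t' : nat) :
  (t <= n * (2 * T + 1))%N -> (t' <= 2 * T)%N ->
  (1 + (t + t') <= n.+1 * (2 * T + 2))%N.
Proof. nia. Qed.

Section GoldenSearch.
Context (R : realType) (S : Type).
Variables (eta delta omega L0 U0 : R) (eval : R -> timed (R * S)).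
Variables (f : R -> R) (T : nat).

(** Interior points only, because the search over the weight divides by alpha and by 1 - alpha. The
    degenerate interval must be allowed for a budget equal to 0. *)
Definition eval_domain (x : R) := L0 <= x <= U0 /\ (L0 < U0 -> L0 < x < U0).

Hypotheses (LU : L0 <= U0) (eta0 : 0 < eta) (delta0 : 0 <= delta).
Hypothesis fconc : concave_on L0 U0 f.
Hypothesis evalP : forall x, eval_domain x -> exists v o t,
  [/\ eval x = Some ((v, o), t), (t <= T)%N & f x - delta <= v <= f x].
Hypothesis modulus : forall x y, L0 <= x <= U0 -> L0 <= y <= U0 ->
  `|x - y| <= eta -> f x - f y <= omega.

(** Evaluation is a function of the point, so a probe evaluated again in the next iteration returns
    the same value. *)
Let fhat x := if eval x is Some ((v, _), _) then v else 0.

Let fhatP x : eval_domain x -> exists o t,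
  [/\ eval x = Some ((fhat x, o), t), (t <= T)%N & f x - delta <= fhat x <= f x].
Proof.
by move=> /evalP [v [w [t [E tT fv]]]]; exists w, t; rewrite /fhat E.
Qed.

Let winner (e : (R * S) * (R * S)) := if e.1.1 < e.2.1 then e.2 else e.1.

Let probe_domain lo hi : L0 <= lo -> lo <= hi -> hi <= U0 ->
  (L0 < U0 -> lo < hi) ->
  eval_domain (hi - phi R * (hi - lo)) /\ eval_domain (lo + phi R * (hi - lo)).
Proof.
move=> h1 h2 h3 h4; have [/andP[a1 a2] /andP[a3 a4]] := probes_le h2.
by split; (split; [apply/andP; split; lra|move=> /h4 /probes_lt [a5 a6 a7];
  apply/andP; split; lra]).
Qed.

Let modulus_in lo hi M q : bracket L0 U0 delta f lo hi M -> hi - lo <= eta ->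
  lo <= q <= hi -> forall x, lo <= x <= hi -> f x - f q <= omega.
Proof.
move=> [a1 a2 a3 _] w /andP[q1 q2] x /andP[x1 x2].
apply: modulus; [apply/andP; split; lra|apply/andP; split; lra|].
by rewrite ler_norml; apply/andP; split; lra.
Qed.

(** Once an iteration has run, [M] is the winning value of the last evaluation, and its point still
    lies in the current interval. That point is also one of the current probes, so the next
    evaluation cannot do worse. *)
Let ginv (s : gstate R S) : Prop := exists M,
  [/\ bracket L0 U0 delta f (g_lo s) (g_hi s) M,
      L0 < U0 -> g_lo s < g_hi s,
      g_1 s = g_hi s - phi R * (g_hi s - g_lo s) /\
      g_2 s = g_lo s + phi R * (g_hi s - g_lo s),
      M <= Num.max (fhat (g_1 s)) (fhat (g_2 s)) &
      forall e, g_last s = Some e ->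
        M = (winner e).1 /\ exists2 q, g_lo s <= q <= g_hi s & eval_domain q /\ M = fhat q].

Let eval2P (s : gstate R S) : ginv s -> exists e1 e2 t,
  [/\ golden_eval2 eval s = Some ((e1, e2), t), (t <= 2 * T)%N,
      e1.1 = fhat (g_1 s) & e2.1 = fhat (g_2 s)].
Proof.
move=> [M [[h1 h2 h3 _] h4 [e1 e2] _ _]].
have [d1 d2] := probe_domain h1 h2 h3 h4.
rewrite -e1 in d1; rewrite -e2 in d2.
have [w1 [t1 [E1 t1T _]]] := fhatP d1; have [w2 [t2 [E2 t2T _]]] := fhatP d2.
exists (fhat (g_1 s), w1), (fhat (g_2 s), w2), (t1 + (t2 + 0))%N.
split => //; last by rewrite addn0 mul2n -addnn leq_add.
by rewrite /golden_eval2 E1 /= E2.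
Qed.

Let stepP s : ginv s -> eta < g_hi s - g_lo s -> exists s' t,
  [/\ golden_step eval s = Some (s', t), (t <= 2 * T + 1)%N, ginv s' &
      g_hi s' - g_lo s' = phi R * (g_hi s - g_lo s)].
Proof.
move=> Is w; have [e1 [e2 [t [E tT v1 v2]]]] := eval2P Is.
case: Is => M [br st [q1 q2] Mle _].
have lohi : g_lo s < g_hi s by have := eta0; lra.
have [h1 h2 h3 _] := br; have [d1 d2] := probe_domain h1 h2 h3 st.
have [_ [_ [_ _ /andP[f1 f1']]]] := fhatP d1.
have [_ [_ [_ _ /andP[f2 f2']]]] := fhatP d2.
rewrite /golden_step E /=.
have [b1 b2 b3] := probes_lt lohi; rewrite -q1 -q2 in b1 b2 b3.
eexists; exists (t + 1)%N; split; first by rewrite /= addn0.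
- by rewrite leq_add2r.
- have [lt|ge] := ltP e1.1 e2.1.
  + exists (fhat (g_2 s)); rewrite /= -v2; split.
    * rewrite q1; apply: (bracket_left fconc delta0 lohi br (v1 := e1.1)) (ltW lt) _ _.
      - by apply: le_trans Mle _; rewrite -v1 -v2 ge_max (ltW lt) lexx.
      - exact: ltW.
      - by rewrite v1 q1.
      - by rewrite v2 q2.
    * by move=> _; apply: lt_trans b3.
    * by split => //; rewrite q1 q2 probe_left.
    * by rewrite v2 le_max lexx.
    * move=> e [<-]; rewrite /winner /= lt; split => //.
      by exists (g_2 s); [apply/andP; split; apply: ltW|split; [rewrite q2|]].
  + exists (fhat (g_1 s)); rewrite /= -v1; split.
    * rewrite q2; apply: (bracket_right fconc delta0 lohi br (v2 := e2.1) (v1 := e1.1)).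
      - by apply: le_trans Mle _; rewrite -v1 -v2 ge_max ge lexx.
      - exact: ge.
      - exact: ge.
      - by rewrite v2 q2.
      - by rewrite v1 q1.
    * by move=> _; apply: lt_trans b2.
    * by split => //; rewrite q1 q2 -probe_right.
    * by rewrite v1 le_max lexx orbT.
    * move=> e [<-]; rewrite /winner /= ltNge ge; split => //.
      by exists (g_1 s); [apply/andP; split; apply: ltW|split; [rewrite q1|]].
- by case: (e1.1 < e2.1) => /=; rewrite ?q1 ?q2; ring.
Qed.

(** The witness [q] keeps the result below the maximum of [f], so that an enclosing search can use
    it as an evaluation with one-sided error. *)
Lemma golden_correct n : (U0 - L0) * phi R ^+ n <= eta -> exists v o t,
  [/\ golden eta eval L0 U0 = Some ((v, o), t),
      (t <= n.+1 * (2 * T + 2))%N,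
      exists2 q, L0 <= q <= U0 & v <= f q &
      forall x, L0 <= x <= U0 -> f x - v <= 3 * delta + omega].
Proof.
move=> wn.
have Iinit : ginv (golden_init S L0 U0).
  exists (fhat (g_1 (golden_init S L0 U0))) => /=; split => //.
  - exact: bracket_init.
  - by rewrite le_max lexx.
have [s [t [E tT Is ws]]] :=
  while_contract (phi_ge0 R) stepP Iinit wn.
rewrite /golden E /=.
case El : (g_last s) => [e|].
  case: (Is) => M [br _ _ _ /(_ _ El) [Mw [q qI [dq Mq]]]].
  exists (winner e).1, (winner e).2, (1 + (t + 0))%N; split.
  - by rewrite /= /winner; case: ifP => _; [case: (e.2)|case: (e.1)].
  - exact: (golden_time tT).
  - have [_ [_ [_ _ /andP[_ fq]]]] := fhatP dq.
    by exists q; [case: dq|rewrite -Mw Mq].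
  - have [_ [_ [_ _ /andP[fq _]]]] := fhatP dq.
    rewrite -Mw; apply: (bracket_final delta0 _ br qI) => //.
      exact: (modulus_in br ws qI).
    by rewrite Mq.
(* The loop body never ran: the initial probes are evaluated now. *)
have [e1 [e2 [t2 [E2 t2T v1 v2]]]] := eval2P Is.
case: (Is) => M [br st [q1 q2] Mle _].
rewrite E2 /=.
have [h1 h2 h3 _] := br; have [d1 d2] := probe_domain h1 h2 h3 st.
have [_ [_ [_ _ /andP[f1 f1']]]] := fhatP d1.
have [_ [_ [_ _ /andP[f2 f2']]]] := fhatP d2.
rewrite -q1 -v1 in f1 f1'; rewrite -q2 -v2 in f2 f2'.
exists (winner (e1, e2)).1, (winner (e1, e2)).2, (1 + (t + (t2 + 0)))%N; split.
- by rewrite /winner /=; case: ifP => _; [case: (e2)|case: (e1)].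
- by rewrite addn0; apply: golden_time.
- rewrite /winner /=; case: ltP => _.
    by exists (g_2 s) => //; rewrite q2; case: d2.
  by exists (g_1 s) => //; rewrite q1; case: d1.
- rewrite -v1 -v2 in Mle.
  rewrite /winner /=; case: ltP => le12.
    apply: (bracket_final delta0 _ br (q := g_2 s)) => //.
      by apply: (modulus_in br ws); rewrite q2; case: (probes_le h2).
      by rewrite q2; case: (probes_le h2).
    by apply: le_trans Mle _; rewrite ge_max (ltW le12) lexx.
  apply: (bracket_final delta0 _ br (q := g_1 s)) => //.
    by apply: (modulus_in br ws); rewrite q1; case: (probes_le h2).
    by rewrite q1; case: (probes_le h2).
  by apply: le_trans Mle _; rewrite ge_max le12 lexx.
Qed.

End GoldenSearch.

(** * Perspectives of concave profiles *)

Section Perspective.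
Context (R : realType).
Implicit Types (h : R -> R).

(* As x / 0 = 0, this is 0 for a = 0, the right value for h of sublinear
   growth. *)
Definition persp h (a b : R) : R := a * h (b / a).

Record concave_profile h : Prop := ConcaveProfile {
  profile_mono : forall u v, 0 <= u -> u <= v -> h u <= h v ;
  profile_conc : forall s t u v, 0 <= s -> 0 <= t -> s + t = 1 ->
    0 <= u -> 0 <= v -> s * h u + t * h v <= h (s * u + t * v) }.

Lemma persp0 h b : persp h 0 b = 0.
Proof. by rewrite /persp mul0r. Qed.

Lemma persp1 h b : persp h 1 b = h b.
Proof. by rewrite /persp mul1r divr1. Qed.

Lemma persp_scale h t a b : 0 <= t -> persp h (t * a) (t * b) = t * persp h a b.
Proof.
rewrite le_eqVlt => /predU1P[<-|t0]; first by rewrite !mul0r persp0.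
rewrite /persp -mulrA; congr (_ * (_ * h _)).
by rewrite invfM mulrACA divff ?mul1r// gt_eqF.
Qed.

Section Profile.
Variable h : R -> R.
Hypothesis hP : concave_profile h.

Lemma persp_mono a b b' : 0 <= a -> 0 <= b -> b <= b' -> persp h a b <= persp h a b'.
Proof.
move=> a0 b0 bb'; apply: ler_wpM2l => //; apply: (profile_mono hP).
  exact: divr_ge0.
by apply: ler_wpM2r => //; rewrite invr_ge0.
Qed.

(** Jensen with weights a / (a + a') and a' / (a + a'). If one weight is 0, its perspective vanishes
    and only monotonicity in the budget remains. *)
Lemma persp_superadditive a b a' b' : 0 <= a -> 0 <= b -> 0 <= a' -> 0 <= b' ->
  persp h a b + persp h a' b' <= persp h (a + a') (b + b').
Proof.
move=> a0 b0 a'0 b'0.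
have [->|an0] := eqVneq a 0.
  by rewrite persp0 !add0r; apply: persp_mono => //; lra.
have [->|a'n0] := eqVneq a' 0.
  by rewrite persp0 !addr0; apply: persp_mono => //; lra.
have ap : 0 < a by rewrite lt_neqAle eq_sym an0.
have a'p : 0 < a' by rewrite lt_neqAle eq_sym a'n0.
have sp : 0 < a + a' by lra.
have sn0 : a + a' != 0 by rewrite gt_eqF.
have := profile_conc hP (s := a / (a + a')) (t := a' / (a + a'))
  (u := b / a) (v := b' / a').
move=> /(_ (divr_ge0 a0 (ltW sp)) (divr_ge0 a'0 (ltW sp))).
rewrite -mulrDl divff// => /(_ erefl (divr_ge0 b0 a0) (divr_ge0 b'0 a'0)) H.
have e1 : a / (a + a') * (b / a) + a' / (a + a') * (b' / a') = (b + b') / (a + a').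
  by field; rewrite sn0 an0 a'n0.
rewrite e1 in H.
rewrite /persp; have := ler_wpM2l (ltW sp) H.
apply: le_trans; rewrite le_eqVlt; apply/orP; left; apply/eqP.
by field.
Qed.

Lemma persp_conc s t a b a' b' : 0 <= s -> 0 <= t -> 0 <= a -> 0 <= b ->
  0 <= a' -> 0 <= b' ->
  s * persp h a b + t * persp h a' b' <= persp h (s * a + t * a') (s * b + t * b').
Proof.
move=> s0 t0 a0 b0 a'0 b'0; rewrite -!persp_scale//.
by apply: persp_superadditive; apply: mulr_ge0.
Qed.

(** Both [x] and [y] are convex combinations of [x + y] and 0, with complementary weights; add the
    two Jensen inequalities. *)
Lemma profile_increment x y : 0 <= x -> 0 <= y -> h (x + y) - h x <= h y - h 0.
Proof.
move=> x0 y0; have [->|yn0] := eqVneq y 0; first by rewrite addr0; lra.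
have sp : 0 < x + y by have : 0 < y by [rewrite lt_neqAle eq_sym yn0]; lra.
have sn0 : x + y != 0 by rewrite gt_eqF.
have cx : 0 <= x / (x + y) by rewrite divr_ge0// ltW.
have cy : 0 <= y / (x + y) by rewrite divr_ge0// ltW.
have e1 : x / (x + y) + y / (x + y) = 1 by field.
have := profile_conc hP cx cy e1 (ltW sp) (lexx 0).
have := profile_conc hP cy cx _ (ltW sp) (lexx 0).
rewrite addrC => /(_ e1).
rewrite !mulr0 !addr0 !divfK// => H1 H2.
have : (x / (x + y) + y / (x + y)) * (h (x + y) + h 0) <= h x + h y by lra.
by rewrite e1 mul1r; lra.
Qed.

End Profile.

(** Hölder moduli with a common exponent. [gap_base] is for the partner profile, which receives
    weight [d] without budget when weight is shifted and so gains only [d * h 0], possibly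
    negative. *)
Record holder_profile h (C D a : R) : Prop := HolderProfile {
  gap_budget : forall al b d, 0 <= al <= 1 -> 0 <= b -> 0 <= d <= D ->
    persp h al (b + d) - persp h al b <= C * d `^ a ;
  gap_weight : forall al b d, 0 <= al -> 0 <= d -> al + d <= 1 -> 0 <= b <= D ->
    persp h (al + d) b - persp h al b <= C * d `^ a ;
  gap_base : forall d, 0 <= d <= 1 -> - (C * d `^ a) <= d * h 0 }.

Lemma holder_profile_le h (C C' D a : R) : C <= C' ->
  holder_profile h C D a -> holder_profile h C' D a.
Proof.
move=> CC' [H1 H2 H3].
have le d : C * d `^ a <= C' * d `^ a by apply: ler_wpM2r; [exact: powR_ge0|].
split => [al b d h1 h2 h3|al b d h1 h2 h3 h4|d h1].
- exact: le_trans (H1 _ _ _ h1 h2 h3) (le d).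
- exact: le_trans (H2 _ _ _ h1 h2 h3 h4) (le d).
- by apply: le_trans (H3 _ h1); rewrite lerN2.
Qed.

Lemma powR_le_bounded (a e d D : R) : 0 < a -> a <= e -> 0 <= d <= D ->
  d `^ e <= D `^ (e - a) * d `^ a.
Proof.
move=> a0 ae /andP[d0 dD].
have e0 : 0 < e by lra.
have [->|dn0] := eqVneq d 0; first by rewrite !powR0 ?gt_eqF// mulr0.
have -> : d `^ e = d `^ (e - a) * d `^ a.
  by rewrite -powRD ?subrK// dn0 implybT.
apply: ler_wpM2r; first exact: powR_ge0.
by apply: ge0_ler_powR; rewrite ?nnegrE; lra.
Qed.

(** Two growth exponents are needed: [e1] controls the budget modulus near 0, [e2] the growth at
    infinity and hence the weight modulus, of order 1 - e2. They differ for p = 1, being 1 and r.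
    The first summand of the constant serves the budget, the others the weight. *)
Lemma holder_profileP h (B e1 e2 a D : R) : concave_profile h -> 0 <= B ->
  0 < a -> a <= e1 -> e1 <= 1 -> 0 <= e2 -> a <= 1 - e2 -> 1 <= D ->
  (forall u, 0 <= u -> h u - h 0 <= B * u `^ e1) ->
  (forall u, 0 <= u -> h u - h 0 <= B * (1 + u `^ e2)) ->
  holder_profile h (B * D `^ (e1 - a) + `|h 0| + B + B * D `^ e2) D a.
Proof.
move=> hP B0 a0 ae1 e11 e20 ae2 D1 h1 h2.
have D0 : 0 <= D by lra.
have hn := normr_ge0 (h 0).
have c1 : 0 <= B * D `^ (e1 - a) by rewrite mulr_ge0 ?powR_ge0.
have c2 : 0 <= B * D `^ e2 by rewrite mulr_ge0 ?powR_ge0.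
have dpow d : 0 <= d <= 1 -> d <= d `^ a.
  move=> /andP[d0 d1]; have [->|dn0] := eqVneq d 0; first exact: powR_ge0.
  by apply: ger1_powR; [rewrite lt_neqAle eq_sym dn0 d0|lra].
have big d x y z : 0 <= x -> 0 <= z -> y <= x * d `^ a -> y <= (x + z) * d `^ a.
  move=> x0 z0 /le_trans; apply; apply: ler_wpM2r; first exact: powR_ge0.
  by lra.
split.
- move=> al b d /andP[al0 al1] b0 /andP[d0 dD].
  rewrite -!addrA; apply: big => //; first by lra.
  have [->|aln0] := eqVneq al 0.
    by rewrite !persp0 subrr mulr_ge0 ?powR_ge0.
  have alp : 0 < al by rewrite lt_neqAle eq_sym aln0.
  apply: (@le_trans _ _ (B * d `^ e1)); last first.
    rewrite -mulrA; apply: ler_wpM2l => //; apply: powR_le_bounded => //.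
    by rewrite d0.
  rewrite /persp -mulrBr mulrDl.
  apply: (@le_trans _ _ (al * (B * (d / al) `^ e1))).
    apply: ler_wpM2l => //; apply: le_trans (h1 _ (divr_ge0 d0 al0)).
    by apply: profile_increment; rewrite ?divr_ge0.
  (* al (d / al)^e1 <= d^e1, because al <= al^e1 for al and e1 in [0, 1]. *)
  rewrite mulrCA; apply: ler_wpM2l => //.
  have -> : d `^ e1 = al `^ e1 * (d / al) `^ e1.
    by rewrite -powRM ?divr_ge0// [al * _]mulrC divfK.
  apply: ler_wpM2r; first exact: powR_ge0.
  by apply: ger1_powR; rewrite ?alp.
- move=> al b d al0 d0 ald /andP[b0 bD].
  have [->|dn0] := eqVneq d 0.
    by rewrite addr0 subrr mulr_ge0 ?powR_ge0//; lra.
  have dp : 0 < d by rewrite lt_neqAle eq_sym dn0.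
  have d1 : d <= 1 by lra.
  (* Split the weight [al + d] and enlarge the radius b / (al + d) to b / al in one part and to b /
     d in the other. *)
  apply: (@le_trans _ _ (d * h (b / d))).
    have hmono : d * h (b / (al + d)) <= d * h (b / d).
      apply: ler_wpM2l => //; apply: (profile_mono hP); first by rewrite divr_ge0//; lra.
      by apply: ler_wpM2l => //; rewrite lef_pV2 ?posrE; lra.
    have [->|aln0] := eqVneq al 0; first by rewrite persp0 add0r subr0.
    have alp : 0 < al by rewrite lt_neqAle eq_sym aln0.
    have hmono' : al * h (b / (al + d)) <= al * h (b / al).
      apply: ler_wpM2l => //; apply: (profile_mono hP); first by rewrite divr_ge0//; lra.
      by apply: ler_wpM2l => //; rewrite lef_pV2 ?posrE; lra.
    by rewrite /persp mulrDl; lra.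
  have hu := h2 _ (divr_ge0 b0 d0).
  have {hu} : d * h (b / d) <= d * (h 0 + B * (1 + (b / d) `^ e2)).
    by apply: ler_wpM2l => //; lra.
  move=> /le_trans; apply.
  have q1 : d * h 0 <= `|h 0| * d `^ a.
    apply: (@le_trans _ _ (d * `|h 0|)).
      by apply: ler_wpM2l => //; exact: ler_norm.
    by rewrite mulrC; apply: ler_wpM2l => //; apply: dpow; rewrite d0.
  have q2 : d * B <= B * d `^ a.
    by rewrite mulrC; apply: ler_wpM2l => //; apply: dpow; rewrite d0.
  have q3 : d * (B * (b / d) `^ e2) <= B * D `^ e2 * d `^ a.
    rewrite mulrCA -mulrA; apply: ler_wpM2l => //.
    rewrite powRM ?invr_ge0// mulrCA.
    apply: ler_pM; rewrite ?powR_ge0 ?mulr_ge0 ?powR_ge0//.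
      by apply: ge0_ler_powR; rewrite ?nnegrE.
    have -> : d * d^-1 `^ e2 = d `^ (1 - e2).
      rewrite powRB ?dn0 ?implybT// powRr1//; congr (_ * _).
      by rewrite -(powR_inv1 d0) -powRrM mulN1r powRN.
    by apply: ger_powR => //; rewrite dp.
  have q4 : 0 <= B * D `^ (e1 - a) * d `^ a by rewrite mulr_ge0 ?powR_ge0.
  by rewrite !mulrDl !mulrDr mulr1; lra.
- move=> d /[dup] dI /andP[d0 d1].
  have q1 : - (`|h 0| * d `^ a) <= d * h 0.
    apply: (@le_trans _ _ (- (`|h 0| * d))).
      by rewrite lerN2; apply: ler_wpM2l => //; apply: dpow.
    rewrite -mulNr mulrC; apply: ler_wpM2l => //.
    by rewrite lerNl -normrN; exact: ler_norm.
  have q4 : 0 <= B * D `^ (e1 - a) * d `^ a by rewrite mulr_ge0 ?powR_ge0.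
  have q5 : 0 <= B * D `^ e2 * d `^ a by rewrite mulr_ge0 ?powR_ge0.
  have q6 : 0 <= B * d `^ a by rewrite mulr_ge0 ?powR_ge0.
  by rewrite !mulrDl; lra.
Qed.

End Perspective.

(** The summand [w] allows two successive uses, which bound a combination s sup A + t sup B.
    Nonemptiness covers r = 0. *)
Lemma sup_scale_le (R : realType) (A : set R) (r v w : R) : 0 <= r -> A !=set0 ->
  (forall x, A x -> r * x + w <= v) -> r * sup A + w <= v.
Proof.
rewrite le_eqVlt => /predU1P[<-|r0] A0 H.
  by have [x /H] := A0; rewrite !mul0r.
suff : sup A <= (v - w) / r by rewrite ler_pdivlMr// mulrC; lra.
by apply: ge_sup => // x /H; rewrite ler_pdivlMr// mulrC; lra.
Qed.

(** * Mixtures of two profiles, as functions of budget split and weight *)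

Section Mixture.
Context (R : realType).
Implicit Types (h : R -> R).

(** The objective of a pair utility once the displacements are maximised out. [best_split] also
    maximises over the budget split and is the target of the inner search. *)
Definition mixture h1 h2 (b al be : R) : R :=
  persp h1 al be + persp h2 (1 - al) (b - be).

Definition best_split h1 h2 (b al : R) : R :=
  sup [set mixture h1 h2 b al be | be in [set be | 0 <= be <= b]].

Lemma mixture_swap h1 h2 b al be :
  mixture h1 h2 b al be = mixture h2 h1 b (1 - al) (b - be).
Proof. by rewrite /mixture !subKr addrC. Qed.

Lemma mixture_conc h1 h2 s t b b' al al' be be' :
  concave_profile h1 -> concave_profile h2 ->
  0 <= s -> 0 <= t -> s + t = 1 -> 0 <= al <= 1 -> 0 <= al' <= 1 ->
  0 <= be <= b -> 0 <= be' <= b' ->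
  s * mixture h1 h2 b al be + t * mixture h1 h2 b' al' be' <=
  mixture h1 h2 (s * b + t * b') (s * al + t * al') (s * be + t * be').
Proof.
move=> P1 P2 s0 t0 st /andP[a0 a1] /andP[a0' a1'] /andP[b0 b1] /andP[b0' b1'].
have := persp_conc P1 s0 t0 a0 b0 a0' b0'.
have := @persp_conc _ _ P2 s t (1 - al) (b - be) (1 - al') (b' - be') s0 t0
  ltac:(lra) ltac:(lra) ltac:(lra) ltac:(lra).
have -> : s * (1 - al) + t * (1 - al') = 1 - (s * al + t * al') by lra.
have -> : s * (b - be) + t * (b' - be') = s * b + t * b' - (s * be + t * be') by ring.
by rewrite /mixture; lra.
Qed.

Lemma three_pointP (f : R -> R) L U :
  (forall s t x z, 0 <= s -> 0 <= t -> s + t = 1 -> L <= x <= U -> L <= z <= U ->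
     s * f x + t * f z <= f (s * x + t * z)) -> concave_on L U f.
Proof.
move=> H x y z Lx xy yz zU.
have w0 : 0 < z - x by lra.
have wn0 : z - x != 0 by rewrite gt_eqF.
have := @H ((z - y) / (z - x)) ((y - x) / (z - x)) x z
  (divr_ge0 _ (ltW w0)) (divr_ge0 _ (ltW w0)).
rewrite -mulrDl => /(_ ltac:(lra) ltac:(lra)).
have -> : (z - y + (y - x)) / (z - x) = 1 by field.
move=> /(_ erefl ltac:(apply/andP; split; lra) ltac:(apply/andP; split; lra)).
have -> : (z - y) / (z - x) * x + (y - x) / (z - x) * z = y by field.
move=> /(ler_wpM2l (ltW w0)); apply: le_trans; rewrite le_eqVlt.
by apply/orP; left; apply/eqP; field.
Qed.

Lemma mixture_conc_budget h1 h2 b al : concave_profile h1 -> concave_profile h2 ->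
  0 <= al <= 1 -> concave_on 0 b (mixture h1 h2 b al).
Proof.
move=> P1 P2 al01; apply: three_pointP => s t x z s0 t0 st xI zI.
have := mixture_conc P1 P2 s0 t0 st al01 al01 xI zI.
by rewrite -!mulrDl st !mul1r.
Qed.

Section Estimates.
Variables (C D a : R).
Hypotheses (C0 : 0 <= C) (D1 : 1 <= D) (a0 : 0 < a).

Let powR_gap (d eta : R) : 0 <= d -> d <= eta -> C * d `^ a <= C * eta `^ a.
Proof.
move=> d0 de; apply: ler_wpM2l => //; have a0' := a0.
by apply: ge0_ler_powR; rewrite ?nnegrE//; lra.
Qed.

Let mixture_mod_budget_le h1 h2 b al x y eta :
  concave_profile h2 -> holder_profile h1 C D a ->
  0 <= al <= 1 -> b <= D -> 0 <= y -> y <= x -> x <= b -> x - y <= eta ->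
  mixture h1 h2 b al x - mixture h1 h2 b al y <= C * eta `^ a.
Proof.
move=> P2 H1 al01 bD y0 yx xb xye.
have /andP[al0 al1] := al01.
have d0 : 0 <= x - y by lra.
have := gap_budget H1 al01 y0 (d := x - y); rewrite (addrC y) subrK.
move=> /(_ ltac:(apply/andP; split; lra)).
have := @persp_mono _ _ P2 (1 - al) (b - x) (b - y) ltac:(lra) ltac:(lra) ltac:(lra).
by have := powR_gap d0 xye; rewrite /mixture; lra.
Qed.

Lemma mixture_mod_budget h1 h2 b al x y eta :
  concave_profile h1 -> concave_profile h2 ->
  holder_profile h1 C D a -> holder_profile h2 C D a ->
  0 <= al <= 1 -> b <= D -> 0 <= x <= b -> 0 <= y <= b -> `|x - y| <= eta ->
  mixture h1 h2 b al x - mixture h1 h2 b al y <= C * eta `^ a.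
Proof.
move=> P1 P2 H1 H2 al01 bD /andP[x0 xb] /andP[y0 yb].
rewrite ler_norml => /andP[xye1 xye2].
have [yx|xy] := leP y x; first exact: mixture_mod_budget_le.
rewrite (mixture_swap _ _ _ _ x) (mixture_swap _ _ _ _ y).
have /andP[al0 al1] := al01.
by apply: mixture_mod_budget_le => //; [apply/andP; split; lra|lra..].
Qed.

(** The first profile gains by [gap_weight]. The second gives up weight [x - y]; superadditivity
    with the pair (x - y, 0) turns this into [gap_base]. *)
Let mixture_mod_weight_le h1 h2 b x y be eta :
  concave_profile h2 -> holder_profile h1 C D a -> holder_profile h2 C D a ->
  0 <= be <= b -> b <= D -> 0 <= y -> y <= x -> x <= 1 -> x - y <= eta ->
  mixture h1 h2 b x be - mixture h1 h2 b y be <= 2 * C * eta `^ a.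
Proof.
move=> P2 H1 H2 /andP[be0 beb] bD y0 yx x1 xye.
have d0 : 0 <= x - y by lra.
have := @gap_weight _ _ _ _ _ H1 y be (x - y) y0 d0; rewrite (addrC y) subrK.
move=> /(_ x1 ltac:(apply/andP; split; lra)).
have := gap_base H2 (d := x - y); move=> /(_ ltac:(apply/andP; split; lra)).
have := @persp_superadditive _ _ P2 (1 - x) (b - be) (x - y) 0 ltac:(lra)
   ltac:(lra) ltac:(lra) ltac:(lra).
rewrite addr0 /(persp h2 (x - y)) mul0r addrA subrK.
by have := powR_gap d0 xye; rewrite /mixture; lra.
Qed.

Lemma mixture_mod_weight h1 h2 b x y be eta :
  concave_profile h1 -> concave_profile h2 ->
  holder_profile h1 C D a -> holder_profile h2 C D a ->
  0 <= be <= b -> b <= D -> 0 <= x <= 1 -> 0 <= y <= 1 -> `|x - y| <= eta ->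
  mixture h1 h2 b x be - mixture h1 h2 b y be <= 2 * C * eta `^ a.
Proof.
move=> P1 P2 H1 H2 beI bD /andP[x0 x1] /andP[y0 y1].
rewrite ler_norml => /andP[xye1 xye2].
have [yx|xy] := leP y x; first exact: mixture_mod_weight_le.
rewrite (mixture_swap _ _ _ x) (mixture_swap _ _ _ y).
have /andP[be0 beb] := beI.
by apply: mixture_mod_weight_le => //; [apply/andP; split; lra|lra..].
Qed.

(** The weight modulus started at weight 0, where the perspective vanishes. *)
Lemma persp_ub h al be : holder_profile h C D a -> 0 <= al <= 1 -> 0 <= be <= D ->
  persp h al be <= C.
Proof.
move=> H /andP[al0 al1] beI.
have := @gap_weight _ _ _ _ _ H 0 be al (lexx 0) al0; rewrite add0r persp0 subr0.
move=> /(_ al1 beI) /le_trans; apply.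
by have := powR_gap al0 al1; rewrite powR1 mulr1.
Qed.

Lemma mixture_ub h1 h2 b al be :
  holder_profile h1 C D a -> holder_profile h2 C D a -> 0 <= al <= 1 ->
  0 <= be <= b -> b <= D -> mixture h1 h2 b al be <= 2 * C.
Proof.
move=> H1 H2 /andP[al0 al1] /andP[be0 beb] bD.
have := @persp_ub h1 al be H1; have := @persp_ub h2 (1 - al) (b - be) H2.
move=> /(_ ltac:(apply/andP; split; lra) ltac:(apply/andP; split; lra)).
move=> + /(_ ltac:(apply/andP; split; lra) ltac:(apply/andP; split; lra)).
by rewrite /mixture; lra.
Qed.

Section BestSplit.
Variables (h1 h2 : R -> R) (b : R).
Hypotheses (P1 : concave_profile h1) (P2 : concave_profile h2).
Hypotheses (H1 : holder_profile h1 C D a) (H2 : holder_profile h2 C D a).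
Hypotheses (b0 : 0 <= b) (bD : b <= D).

Lemma best_split_ge al be : 0 <= al <= 1 -> 0 <= be <= b ->
  mixture h1 h2 b al be <= best_split h1 h2 b al.
Proof.
move=> al01 beI; apply: ub_le_sup; last by exists be.
by exists (2 * C) => _ [be' be'I <-]; apply: mixture_ub.
Qed.

Lemma best_split_le al y :
  (forall be, 0 <= be <= b -> mixture h1 h2 b al be <= y) ->
  best_split h1 h2 b al <= y.
Proof.
move=> H; apply: ge_sup; last by move=> _ [be beI <-]; apply: H.
by exists (mixture h1 h2 b al 0), 0 => //=; rewrite lexx.
Qed.

(** A partial maximum of a jointly concave function is concave. *)
Lemma best_split_conc : concave_on 0 1 (best_split h1 h2 b).
Proof.
apply: three_pointP => s t x z s0 t0 st xI zI.
set G := best_split _ _ _.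
have Hx be be' : 0 <= be <= b -> 0 <= be' <= b ->
    s * mixture h1 h2 b x be + t * mixture h1 h2 b z be' <= G (s * x + t * z).
  move=> beI be'I; have := mixture_conc P1 P2 s0 t0 st xI zI beI be'I.
  rewrite -(mulrDl _ _ b) st mul1r => /le_trans; apply.
  have /andP[x0 x1] := xI; have /andP[z0 z1] := zI.
  have /andP[be0 beb] := beI; have /andP[be0' beb'] := be'I.
  apply: best_split_ge; apply/andP; split; try by rewrite addr_ge0// mulr_ge0.
    by rewrite -st lerD// ler_piMr.
  by rewrite -[leRHS]mul1r -st mulrDl lerD// ler_wpM2l.
have ne al : [set mixture h1 h2 b al be | be in [set be | 0 <= be <= b]] !=set0.
  by exists (mixture h1 h2 b al 0), 0 => //=; rewrite lexx.
apply: sup_scale_le => // _ [be beI <-]; rewrite addrC.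
by apply: sup_scale_le => // _ [be' be'I <-]; rewrite addrC; apply: Hx.
Qed.

Lemma best_split_mod x y eta : 0 <= x <= 1 -> 0 <= y <= 1 -> `|x - y| <= eta ->
  best_split h1 h2 b x - best_split h1 h2 b y <= 2 * C * eta `^ a.
Proof.
move=> xI yI xye; rewrite lerBlDr; apply: best_split_le => be beI.
have := mixture_mod_weight P1 P2 H1 H2 beI bD xI yI xye.
by have := best_split_ge yI beI; lra.
Qed.

End BestSplit.
End Estimates.
End Mixture.

(** * The utility as a concave envelope *)

Section Value.
Context (R : realType) (K : nat).
Variables (h : 'I_K -> R -> R) (C D a : R).

Definition mixtures (b : R) : set R :=
  [set y | exists (k1 k2 : 'I_K) (al be : R), [/\ (k1 < k2)%N, 0 <= al <= 1, 0 <= be <= b &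
    y = mixture (h k1) (h k2) b al be]].

Definition value (b : R) : R := sup (mixtures b).

Hypotheses (K2 : (2 <= K)%N) (C0 : 0 <= C) (D1 : 1 <= D) (a0 : 0 < a).
Hypothesis hP : forall k, concave_profile (h k).
Hypothesis hH : forall k, holder_profile (h k) C D a.

Let other (k : 'I_K) : exists k', k' != k.
Proof.
have [->|kn0] := eqVneq k (Ordinal (ltnW K2)); last first.
  by exists (Ordinal (ltnW K2)); rewrite eq_sym.
by exists (Ordinal K2).
Qed.

Lemma value_ge b y : b <= D -> mixtures b y -> y <= value b.
Proof.
move=> bD yb; apply: ub_le_sup => //; exists (2 * C) => _ [k1 [k2 [al [be [_ h1 h2 ->]]]]].
exact: (mixture_ub C0 a0 (hH k1) (hH k2)).
Qed.

Lemma value_le b y : 0 <= b -> (forall x, mixtures b x -> x <= y) -> value b <= y.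
Proof.
move=> b0 H; apply: ge_sup; last exact: H.
exists (mixture (h (Ordinal (ltnW K2))) (h (Ordinal K2)) b 0 0).
exists (Ordinal (ltnW K2)), (Ordinal K2), 0, 0.
by split => //; rewrite lexx ?ler01.
Qed.

Lemma mixture_le_value k1 k2 b al be : k1 != k2 -> 0 <= al <= 1 -> 0 <= be <= b ->
  b <= D -> mixture (h k1) (h k2) b al be <= value b.
Proof.
move=> k12 alI beI bD; have [lt|gt|eq] := ltngtP k1 k2.
- by apply: value_ge => //; exists k1, k2, al, be.
- apply: value_ge => //; exists k2, k1, (1 - al), (b - be).
  move/andP: alI => [al0 al1]; move/andP: beI => [be0 be1].
  by split; [|apply/andP; split; lra|apply/andP; split; lra|exact: mixture_swap].
- by move: k12; rewrite (val_inj eq) eqxx.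
Qed.

Lemma profile_le_value k b : 0 <= b -> b <= D -> h k b <= value b.
Proof.
move=> b0 bD; have [k' k'k] := other k.
have := @mixture_le_value k k' b 1 b; rewrite eq_sym k'k lexx ler01 b0 bD.
by rewrite /mixture !subrr persp0 addr0 persp1 lexx; apply.
Qed.

(** The indices may coincide, although [mixtures] wants distinct ones: concavity then reduces the
    chord to one profile, paired with an arbitrary partner of weight 0. *)
Lemma chord_le_value k k' s t u u' b : 0 <= s -> 0 <= t -> s + t = 1 ->
  0 <= u -> 0 <= u' -> s * u + t * u' = b -> b <= D ->
  s * h k u + t * h k' u' <= value b.
Proof.
move=> s0 t0 st u0 u'0 bE bD.
have su : 0 <= s * u by rewrite mulr_ge0.
have tu : 0 <= t * u' by rewrite mulr_ge0.
have b0 : 0 <= b by lra.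
have [->|kk'] := eqVneq k k'.
  apply: le_trans (profile_le_value k' b0 bD).
  by have := profile_conc (hP k') s0 t0 st u0 u'0; rewrite bE.
have := @mixture_le_value k k' b s (s * u) kk'.
have -> : 0 <= s <= 1 by apply/andP; split; lra.
have -> : 0 <= s * u <= b by apply/andP; split; lra.
move=> /(_ isT isT bD); apply: le_trans.
have ts : 1 - s = t by lra.
have tu' : b - s * u = t * u' by lra.
have perspE k0 r w : 0 <= r -> persp (h k0) r (r * w) = r * h k0 w.
  by move=> r0; have := persp_scale (h k0) 1 w r0; rewrite mulr1 persp1.
by rewrite /mixture ts tu' !perspE.
Qed.

(* A line through (b, value b) above all profiles: the slopes to the right of b
   are below the slopes to its left because the chords lie below value b. *)
Lemma value_support b : 0 < b -> b <= D -> exists2 sg, 0 <= sg &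
  forall k u, 0 <= u -> h k u <= value b + sg * (u - b).
Proof.
move=> b0 bD; set v := value b.
pose right_slopes : set R := [set s | exists k u, b < u /\ s = (h k u - v) / (u - b)].
have sep k u k' u' : 0 <= u -> u < b -> b < u' ->
    (h k' u' - v) / (u' - b) <= (v - h k u) / (b - u).
  move=> u0 ub bu'.
  have c1 : 0 < u' - b by lra.
  have c2 : 0 < b - u by lra.
  have c3 : 0 < u' - u by lra.
  have n3 : u' - u != 0 by rewrite gt_eqF.
  rewrite ler_pdivrMr// mulrAC ler_pdivlMr//.
  have := @chord_le_value k k' ((u' - b) / (u' - u)) ((b - u) / (u' - u)) u u' b.
  move=> /(_ (divr_ge0 (ltW c1) (ltW c3)) (divr_ge0 (ltW c2) (ltW c3))).
  move=> /(_ ltac:(field; exact n3) u0 ltac:(lra) ltac:(field; exact n3) bD).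
  move=> /(ler_wpM2l (ltW c3)).
  have -> : (u' - u) * ((u' - b) / (u' - u) * h k u + (b - u) / (u' - u) * h k' u')
    = (u' - b) * h k u + (b - u) * h k' u' by field.
  by rewrite -/v; lra.
have rs0 : right_slopes !=set0.
  exists ((h (Ordinal K2) (b + 1) - v) / (b + 1 - b)), (Ordinal K2), (b + 1).
  by split=> //; lra.
have rsub k u : 0 <= u -> u < b -> ubound right_slopes ((v - h k u) / (b - u)).
  by move=> u0 ub _ [k' [u' [bu' ->]]]; apply: sep.
(* Cutting the slope off at 0 is harmless because profiles are nondecreasing; [value_conc] needs the
   sign. *)
exists (Num.max 0 (sup right_slopes)); first by rewrite le_max lexx.
move=> k u u0; have [ub|bu|->] := ltgtP u b; last first.
- by rewrite subrr mulr0 addr0; apply: profile_le_value => //; exact: ltW.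
- have c : 0 < u - b by lra.
  suff : (h k u - v) / (u - b) <= Num.max 0 (sup right_slopes).
    by rewrite ler_pdivrMr//; lra.
  rewrite le_max; apply/orP; right; apply: ub_le_sup; last by exists k, u.
  by exists ((v - h k 0) / (b - 0)); apply: rsub.
- have c : 0 < b - u by lra.
  suff : Num.max 0 (sup right_slopes) <= (v - h k u) / (b - u).
    by rewrite ler_pdivlMr//; lra.
  rewrite ge_max; apply/andP; split; last by apply: ge_sup => //; exact: rsub.
  apply: divr_ge0; last exact: ltW.
  have := profile_mono (hP k) u0 (ltW ub).
  by have := profile_le_value k (ltW b0) bD; rewrite -/v; lra.
Qed.

(** The perspective of an affine majorant is linear in weight and budget, so a line above all
    profiles is above all mixtures, hence above [value]. A line touching at [y] gives the
    three-point inequality. *)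
Lemma value_conc : concave_on 0 D value.
Proof.
move=> x y z x0 xy yz zD.
have y0 : 0 < y by lra.
have yD : y <= D by lra.
have [sg sg0 sgP] := value_support y0 yD.
set v := value y in sgP *.
have line k al be : 0 <= al -> 0 <= be ->
    persp (h k) al be <= al * (v - sg * y) + sg * be.
  (* At weight 0 some budget [be] may still be allotted; [sg >= 0] covers it. *)
  move=> al0 be0; have [->|aln0] := eqVneq al 0.
    by rewrite persp0 mul0r add0r mulr_ge0.
  have /(ler_wpM2l al0) := sgP k _ (divr_ge0 be0 al0).
  rewrite /persp; have -> : al * (v + sg * (be / al - y)) =
    al * (v - sg * y) + sg * be by field.
  by [].
have bd b' : 0 <= b' -> value b' <= v + sg * (b' - y).
  move=> b'0; apply: value_le => // _ [k1 [k2 [al [be [_ /andP[al0 al1] /andP[be0 be1] ->]]]]].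
  have := line k1 al be al0 be0; have := line k2 (1 - al) (b' - be).
  by rewrite !subr_ge0 => /(_ al1 be1); rewrite /mixture; lra.
have bx := bd _ x0; have bz := bd z ltac:(lra).
have c1 : 0 <= z - y by lra.
have c2 : 0 <= y - x by lra.
have := ler_wpM2l c1 bx; have := ler_wpM2l c2 bz; lra.
Qed.

Lemma value_mod x y eta : 0 <= y -> y <= x -> x <= D -> x - y <= eta ->
  value x - value y <= 2 * C * eta `^ a.
Proof.
move=> y0 yx xD xye; rewrite lerBlDr; apply: value_le; first lra.
move=> _ [k1 [k2 [al [be [k12 alI /andP[be0 be1] ->]]]]].
have gap d : 0 <= d -> d <= eta -> C * d `^ a <= C * eta `^ a.
  move=> d0 de; apply: ler_wpM2l => //.
  by apply: ge0_ler_powR; rewrite ?nnegrE//; [exact: ltW|lra].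
have [/andP[al0 al1]] := alI.
(* The cut [x - y] comes from the first share as far as it reaches, the rest from the second: two
   gaps, hence 2 C. *)
have [d1 [d10 d1x d1be d1r]] : exists d1,
    [/\ 0 <= d1, d1 <= x - y, d1 <= be & x - y - d1 <= x - be].
  by have [le|lt] := leP be (x - y); [exists be|exists (x - y)]; split; lra.
pose d2 := x - y - d1; have d2E : d2 = x - y - d1 by [].
have d20 : 0 <= d2 by lra.
have m1 : persp (h k1) al be - persp (h k1) al (be - d1) <= C * d1 `^ a.
  have := gap_budget (hH k1) alI (b := be - d1) (d := d1); rewrite subrK; apply.
    lra.
  by apply/andP; split; lra.
have m2 : persp (h k2) (1 - al) (x - be) - persp (h k2) (1 - al) (x - be - d2)
    <= C * d2 `^ a.
  have := @gap_budget _ _ _ _ _ (hH k2) (1 - al) (x - be - d2) d2; rewrite subrK; apply.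
  - by apply/andP; split; lra.
  - lra.
  - by apply/andP; split; lra.
have : mixture (h k1) (h k2) y al (be - d1) <= value y.
  apply: value_ge; first lra.
  by exists k1, k2, al, (be - d1); split => //; apply/andP; split; lra.
have e2 : y - (be - d1) = x - be - d2 by lra.
have := gap _ d10 ltac:(lra); have := gap _ d20 ltac:(lra).
by rewrite /mixture e2; lra.
Qed.

End Value.

(** * Error and running time of the nested searches *)

Section AlgorithmAnalysis.
Context (R : realType) (m K N : nat).
Variables (zhat : 'I_N -> 'rV[R]_m) (rho : R) (WCO : oracle R m K).
Variables (eps eta : R) (i : 'I_N).
Variables (h : 'I_K -> R -> R) (C D a : R) (cost n : nat).

Hypotheses (K2 : (2 <= K)%N) (C0 : 0 <= C) (D1 : 1 <= D) (a0 : 0 < a).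
Hypotheses (eps0 : 0 < eps) (eta0 : 0 < eta).
Hypothesis hP : forall k, concave_profile (h k).
Hypothesis hH : forall k, holder_profile (h k) C D a.
Hypothesis oracleP : forall k u, 0 <= u -> exists L v t,
  [/\ WCO eps k (zhat i) u = ((L, v), t), (t <= cost)%N & h k u - eps <= L <= h k u].
Hypothesis nP : D * phi R ^+ n <= eta.

Let e := eta `^ a.

Let Ce_ge0 : 0 <= C * e. Proof. by rewrite mulr_ge0 ?powR_ge0. Qed.

Let iterations w : w <= D -> w * phi R ^+ n <= eta.
Proof.
move=> wD; apply: le_trans nP; apply: ler_wpM2r => //.
exact: exprn_ge0 (phi_ge0 R).
Qed.

Lemma inner_correct k1 k2 b al : 0 <= b -> b <= D -> 0 < al < 1 -> exists v w t,
  [/\ inner_solver zhat WCO eps eta i k1 k2 b al = Some ((v, w), t),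
      (t <= n.+1 * (2 * (2 * cost) + 2))%N &
      best_split (h k1) (h k2) b al - (3 * eps + C * e) <= v
        <= best_split (h k1) (h k2) b al].
Proof.
move=> b0 bD /andP[al0 al1]; have al01 : 0 <= al <= 1 by rewrite !ltW.
have al2 : 0 < 1 - al by lra.
rewrite /inner_solver.
set ev := (X in golden _ X).
have evP x : eval_domain 0 b x -> exists v w t, [/\ ev x = Some ((v, w), t),
    (t <= 2 * cost)%N &
    mixture (h k1) (h k2) b al x - eps <= v <= mixture (h k1) (h k2) b al x].
  move=> [/andP[x0 xb] _].
  have [L1 [v1 [t1 [E1 t1c /andP[l1 u1]]]]] := oracleP k1 (divr_ge0 x0 (ltW al0)).
  have bx0 : 0 <= b - x by lra.
  have [L2 [v2 [t2 [E2 t2c /andP[l2 u2]]]]] := oracleP k2 (divr_ge0 bx0 (ltW al2)).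
  rewrite /ev /call_oracle E1 /= E2 /=; do 3 eexists; split; first reflexivity.
    by rewrite addn0 mul2n -addnn leq_add.
  have := ler_wpM2l (ltW al0) l1; have := ler_wpM2l (ltW al0) u1.
  have := ler_wpM2l (ltW al2) l2; have := ler_wpM2l (ltW al2) u2.
  by rewrite /mixture /persp => *; apply/andP; split; lra.
have [] := golden_correct (eta := eta) (omega := C * e) b0 eta0 (ltW eps0)
  (mixture_conc_budget (hP k1) (hP k2) al01) evP _ (n := n).
- move=> x y xI yI xye.
  exact: (mixture_mod_budget C0 a0 (hP k1) (hP k2) (hH k1) (hH k2) al01 bD).
- by rewrite subr0; exact: iterations.
move=> v [w [t [E tT [q qI vq] lo]]]; exists v, w, t; split => //.
apply/andP; split.
  rewrite lerBlDr; apply: best_split_le => // be /lo; lra.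
apply: le_trans vq _.
exact: (best_split_ge C0 a0 (hH k1) (hH k2) bD).
Qed.

Lemma pair_correct k1 k2 b : 0 <= b -> b <= D -> exists v w t,
  [/\ pair_eval zhat WCO eps eta i k1 k2 b = Some ((v, w), t),
      (t <= n.+1 * (2 * (n.+1 * (2 * (2 * cost) + 2)) + 2))%N,
      exists2 q, 0 <= q <= 1 & v <= best_split (h k1) (h k2) b q &
      forall al be, 0 <= al <= 1 -> 0 <= be <= b ->
        mixture (h k1) (h k2) b al be - v <= 9 * eps + 5 * (C * e)].
Proof.
move=> b0 bD.
have d0 : 0 <= 3 * eps + C * e by have := eps0; have := Ce_ge0; lra.
have evP al : eval_domain 0 1 al -> exists v w t,
    [/\ inner_solver zhat WCO eps eta i k1 k2 b al = Some ((v, w), t),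
      (t <= n.+1 * (2 * (2 * cost) + 2))%N &
      best_split (h k1) (h k2) b al - (3 * eps + C * e) <= v
        <= best_split (h k1) (h k2) b al].
  by move=> [_ /(_ ltr01)]; apply: inner_correct.
have [] := golden_correct (eta := eta) (omega := 2 * C * e) ler01 eta0 d0
  (best_split_conc C0 a0 (hP k1) (hP k2) (hH k1) (hH k2) b0 bD) evP _ (n := n).
- move=> x y xI yI xye.
  exact: (best_split_mod C0 a0 (hP k1) (hP k2) (hH k1) (hH k2) b0 bD).
- by rewrite subr0; exact: iterations.
move=> v [w [t [E tT qP lo]]]; exists v, w, t; split => // al be alI beI.
have := lo _ alI; have := best_split_ge C0 a0 (hH k1) (hH k2) bD alI beI; lra.
Qed.

(** [A k] collects the values that pair [k] must nearly reach. The last conclusion, that the running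
    best never decreases, carries the induction. *)
Lemma best_pair_correct b (T : nat) (ub err : R) (A : 'I_K * 'I_K -> R -> Prop) ks :
  (forall k, k \in ks -> exists v w t,
     [/\ pair_eval zhat WCO eps eta i k.1 k.2 b = Some ((v, w), t), (t <= T)%N,
         v <= ub & forall x, A k x -> x - err <= v]) ->
  forall best, (best = None -> ks <> [::]) ->
  (forall o, best = Some o -> o.1.1 <= ub) ->
  exists out t,
    [/\ best_pair zhat WCO eps eta i b ks best = Some (out, t),
        (t <= size ks * T.+1)%N, out.1.1 <= ub,
        forall k x, k \in ks -> A k x -> x - err <= out.1.1 &
        forall o, best = Some o -> o.1.1 <= out.1.1].
Proof.
elim: ks => [|k ks IH] Hk best nonempty bub.
  case: best nonempty bub => [out|/(_ erefl)//] _ bub.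
  by exists out, 0%N; split => //; [exact: bub|move=> _ [<-]].
have [v [w [t [E tT vub vA]]]] := Hk k (mem_head _ _).
rewrite [best_pair _ _ _ _ _ _ _ _]/= E /=.
set best' := (X in best_pair _ _ _ _ _ _ _ X).
have [] := IH _ best'.
- by move=> k' k'ks; apply: Hk; rewrite inE k'ks orbT.
- by rewrite /best'; case: (best) => // ?; case: ifP.
- rewrite /best'; case: (best) bub => [q|] bub out; last by case=> <-.
  by case: ifP => _ [<-] //; apply: bub.
move=> out [t' [E' t'T oub oA ob]].
have [p' bp' [vp' bo]] : exists2 p', best' = Some p' &
    v <= p'.1.1 /\ forall q, best = Some q -> q.1.1 <= p'.1.1.
  rewrite /best'; case: (best) => [q|]; last by exists (v, w, k).
  case: ltP => vq; [exists (v, w, k)|exists q] => //; split => //= _ [<-] //.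
  exact: ltW.
have := ob _ bp' => pout.
exists out, (t + (1 + t'))%N; split => //.
- by rewrite E'.
- by rewrite /= mulSn addnA leq_add// addn1 ltnS.
- move=> k' x; rewrite inE => /predU1P[-> /vA|]; last exact: oA.
  by move=> /le_trans; apply; apply: le_trans pout.
- by move=> q /bo /le_trans; apply.
Qed.

Let Tpair := (n.+1 * (2 * (n.+1 * (2 * (2 * cost) + 2)) + 2))%N.
Let err := 9 * eps + 5 * (C * e).

Lemma local_correct b : 0 <= b -> b <= D -> exists out t,
  [/\ local_eval zhat WCO eps eta i b = Some (out, t), (t <= K ^ 2 * Tpair.+1)%N &
      value h b - err <= out.1.1 <= value h b].
Proof.
move=> b0 bD; rewrite /local_eval.
set ks := (X in best_pair _ _ _ _ _ _ X).
pose A (k : 'I_K * 'I_K) x := exists al be,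
  [/\ 0 <= al <= 1, 0 <= be <= b & x = mixture (h k.1) (h k.2) b al be].
have [|||out [t [E tT oub oA _]]] :=
    @best_pair_correct b Tpair (value h b) err A ks _ None.
- move=> k; rewrite mem_filter => /andP[k12 _].
  have [v [w [t [E tT [q qI vq] lo]]]] := pair_correct k.1 k.2 b0 bD.
  exists v, w, t; split => //.
    apply: le_trans vq _; apply: best_split_le => // be beI.
    by apply: (value_ge C0 a0 hH) => //; exists k.1, k.2, q, be.
  by move=> _ [al [be [alI beI ->]]]; have := lo _ _ alI beI; rewrite /err; lra.
- move=> _ ks0; have : (Ordinal (ltnW K2), Ordinal K2) \in ks.
    by rewrite mem_filter mem_enum.
  by rewrite ks0.
- by [].
exists out, t; split => //.
- apply: leq_trans tT _; rewrite leq_mul2r; apply/orP; right.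
  rewrite size_filter (leq_trans (count_size _ _))// -cardT card_prod card_ord.
  by rewrite expnS expn1.
- rewrite oub andbT lerBlDr; apply: (value_le K2) => //.
  move=> _ [k1 [k2 [al [be [k12 alI beI ->]]]]].
  have := @oA (k1, k2) (mixture (h k1) (h k2) b al be).
  rewrite mem_filter mem_enum k12 => /(_ isT); rewrite lerBlDr; apply.
  by exists al, be.
Qed.

Let Tlocal := (K ^ 2 * Tpair.+1)%N.

Lemma budget_correct lambda : 0 < N%:R * rho -> N%:R * rho <= D -> 0 <= lambda ->
  exists bhat out t,
  [/\ budget_eval zhat rho WCO eps eta i lambda = Some ((bhat, out), t),
      (t <= 1 + (Tlocal + (Tlocal + (n * Tlocal.+1 + Tlocal))))%N &
      forall b, 0 <= b <= N%:R * rho ->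
        value h b - lambda * b - (out.1.1 - lambda * bhat)
          <= 36 * eps + 24 * (C * e)].
Proof.
set W := N%:R * rho => W0 WD lambda0.
pose f b := value h b - lambda * b.
have fconc : concave_on 0 W f.
  move=> x y z x0 xy yz zW.
  have := value_conc K2 C0 a0 hP hH x0 xy yz (le_trans zW WD); rewrite /f; lra.
have err0 : 0 <= err by rewrite /err; have := eps0; have := Ce_ge0; lra.
have localP b : 0 <= b -> b <= W -> exists out t,
    [/\ local_eval zhat WCO eps eta i b = Some (out, t), (t <= Tlocal)%N &
      f b - err <= out.1.1 - lambda * b <= f b].
  move=> b0 bW; have [out [t [E tT /andP[h1 h2]]]] := local_correct b0 (le_trans bW WD).
  by exists out, t; split => //; rewrite /f; apply/andP; split; lra.
pose v1 (s : bstate R) := b_V1 s - lambda * b_1 s.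
pose v2 (s : bstate R) := b_V2 s - lambda * b_2 s.
(* Only the new probe is evaluated in each iteration, so accuracy of both carried values belongs to
   the invariant. *)
pose binv (s : bstate R) :=
  [/\ bracket 0 W err f (b_lo s) (b_hi s) (Num.max (v1 s) (v2 s)),
    b_lo s < b_hi s,
    b_1 s = b_hi s - phi R * (b_hi s - b_lo s) /\
    b_2 s = b_lo s + phi R * (b_hi s - b_lo s),
    f (b_1 s) - err <= v1 s <= f (b_1 s) &
    f (b_2 s) - err <= v2 s <= f (b_2 s)].
have stepP s : binv s -> eta < b_hi s - b_lo s -> exists s' t,
    [/\ budget_step zhat WCO eps eta i lambda s = Some (s', t), (t <= Tlocal.+1)%N,
      binv s' & b_hi s' - b_lo s' = phi R * (b_hi s - b_lo s)].
  move=> [br lohi [q1 q2] V1 V2] _; have [h1 h2 h3 _] := br.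
  have [p1 p2 p3] := probes_lt lohi; rewrite -q1 -q2 in p1 p2 p3.
  have /andP[f1 f1'] := V1; have /andP[f2 f2'] := V2.
  rewrite /budget_step /= -/(v1 s) -/(v2 s).
  have [lt|ge] := ltP (v1 s) (v2 s).
    have lohi' : b_1 s < b_hi s by apply: lt_trans p3.
    have [r1 r2 r3] := probes_lt lohi'.
    have [] := @localP (b_1 s + phi R * (b_hi s - b_1 s)) ltac:(lra) ltac:(lra).
    move=> out [t [-> tT V]] /=; do 2 eexists; split; first reflexivity.
    - by rewrite addn0.
    - split => //=.
      + rewrite q1; apply: (bracket_left fconc err0 lohi br (v1 := v1 s) (v2 := v2 s)).
        * apply: (@le_trans _ _ (v2 s)); first by rewrite ge_max (ltW lt) lexx.
          by rewrite le_max; apply/orP; left; exact: lexx.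
        * by rewrite le_max; apply/orP; left; exact: ltW lt.
        * exact: ltW.
        * by rewrite -q1.
        * by rewrite -q2.
      + by split => //; rewrite q1 q2 probe_left.
    - by rewrite /= q1; ring.
  have lohi' : b_lo s < b_2 s by apply: lt_trans p2.
  have [r1 r2 r3] := probes_lt lohi'.
  have [] := @localP (b_2 s - phi R * (b_2 s - b_lo s)) ltac:(lra) ltac:(lra).
  move=> out [t [-> tT V]] /=; do 2 eexists; split; first reflexivity.
  - by rewrite addn0.
  - split => //=.
    + rewrite q2; apply: (bracket_right fconc err0 lohi br (v1 := v1 s) (v2 := v2 s)).
      * apply: (@le_trans _ _ (v1 s)); first by rewrite ge_max ge lexx.
        by rewrite le_max; apply/orP; right; exact: lexx.
      * by rewrite le_max; apply/orP; right; exact: ge.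
      * exact: ge.
      * by rewrite -q2.
      * by rewrite -q1.
    + by split => //; rewrite q1 q2 -probe_right.
  - by rewrite /= q2; ring.
have [c1 c2 c3] := probes_lt W0.
rewrite /budget_eval -/W.
have [] := @localP (W - phi R * (W - 0)) ltac:(lra) ltac:(lra).
move=> o1 [t1 [-> t1T V1]] /=.
have [] := @localP (0 + phi R * (W - 0)) ltac:(lra) ltac:(lra).
move=> o2 [t2 [-> t2T V2]] /=.
set s0 := BState _ _ _ _ _ _.
have Is0 : binv s0 by split => //=; exact: bracket_init (ltW W0).
have w0 : (b_hi s0 - b_lo s0) * phi R ^+ n <= eta.
  by rewrite /= subr0; exact: iterations.
have [s [tw [-> twT Is ws]]] := while_contract (phi_ge0 R) stepP Is0 w0.
have [br lohi [q1 q2] U1 U2] := Is; have [h1 h2 h3 _] := br.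
rewrite /=.
have [] := @localP (b_lo s) h1 ltac:(lra).
move=> out [t3 [-> t3T /andP[V3 V3']]] /=.
exists (b_lo s), out, (1 + (t1 + (t2 + (tw + (t3 + 0)))))%N; split => //.
  by rewrite addn0 leq_add2l !leq_add.
(* At the left end point the term [- lambda * b] is largest, so the bound is free of [lambda]. *)
have mod x : b_lo s <= x <= b_hi s -> f x - f (b_lo s) <= 2 * C * e.
  move=> /andP[x1 x2].
  have := @value_mod _ _ h C D a K2 C0 a0 hH x (b_lo s) eta h1 x1 ltac:(lra) ltac:(lra).
  have xl0 : 0 <= x - b_lo s by lra.
  by have := mulr_ge0 lambda0 xl0; rewrite /f -/e; lra.
have [p1 p2 p3] := probes_lt lohi; rewrite -q1 -q2 in p1 p2 p3.
have m1 := mod (b_1 s) ltac:(apply/andP; split; lra).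
have m2 := mod (b_2 s) ltac:(apply/andP; split; lra).
have /andP[_ u1] := U1; have /andP[_ u2] := U2.
have w00 := Ce_ge0.
move=> b bI.
(* The returned value may be worse than the best probe, by at most err + 2 C e. Raising it by this
   amount makes it dominate [M]; altogether 4 err + 4 C e. *)
have := @bracket_final _ _ _ _ _ err0 (2 * C * e) _ _ _
   (out.1.1 - lambda * b_lo s + err + 2 * C * e) (b_lo s) mod br
   ltac:(rewrite lexx; exact: ltW) ltac:(rewrite ge_max; apply/andP; split; lra)
   ltac:(lra) b bI.
by rewrite /f /err; lra.
Qed.

End AlgorithmAnalysis.

(** * Worst-case profiles *)

Section ConcaveLinearBound.
Context (R : realType).

Definition concave_fun (E : lmodType R) (f : E -> R) : Prop :=
  forall s t x y, 0 <= s -> 0 <= t -> s + t = 1 ->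
    s * f x + t * f y <= f (s *: x + t *: y).

Lemma concave_funP (E : lmodType R) (f : E -> R) :
  @convex_function R E setT (fun z => - f z) -> concave_fun f.
Proof.
move=> fc s t x y s0 t0 st.
have s1 : s <= 1 by lra.
have := fc (Itv01 s0 s1) x y; rewrite !inE => /(_ I I).
move=> H; have -> : t = 1 - s by lra.
suff : - f (s *: x + (1 - s) *: y) <= s * - f x + (1 - s) * - f y by lra.
exact: H.
Qed.

(** Induction on the directions: a point of the box is the combination, with weights (1 + t j) / 2
    and (1 - t j) / 2, of points on two opposite faces. *)
Lemma concave_box_lb (m : nat) (f : 'rV[R]_m -> R) (I : Type) (s : seq I)
    (u : I -> 'rV[R]_m) : concave_fun f -> forall x, exists M, forall t : I -> R,
  (forall j, `|t j| <= 1) -> M <= f (x + \sum_(j <- s) t j *: u j).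
Proof.
move=> fc; elim: s => [|j s IH] x.
  by exists (f x) => t _; rewrite big_nil addr0.
have [M1 HM1] := IH (x + u j); have [M2 HM2] := IH (x - u j).
exists (Num.min M1 M2) => t tP; rewrite big_cons.
move: (\sum_(_ <- _) _) (HM1 t tP) (HM2 t tP) => w h1 h2.
have := tP j; rewrite ler_norml => /andP[t1 t2].
have c1 : 0 <= (1 + t j) / 2 by lra.
have c2 : 0 <= (1 - t j) / 2 by lra.
have := fc _ _ (x + u j + w) (x - u j + w) c1 c2 ltac:(lra).
have -> : (1 + t j) / 2 *: (x + u j + w) + (1 - t j) / 2 *: (x - u j + w) =
    x + (t j *: u j + w).
  by apply/rowP => k; rewrite !mxE; field.
apply: le_trans.
have m1 : Num.min M1 M2 <= f (x + u j + w) by rewrite ge_min h1.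
have m2 : Num.min M1 M2 <= f (x - u j + w) by rewrite ge_min h2 orbT.
have := ler_wpM2l c1 m1; have := ler_wpM2l c2 m2; lra.
Qed.

End ConcaveLinearBound.

(** * Linear growth of concave functions and comparison of norms *)

Section RowVectors.
Context (R : realType) (m : nat).
Implicit Types (v w : 'rV[R]_m) (nrm : 'rV[R]_m -> R).

Lemma coord_le_norm v j : `|v ord0 j| <= `|v|.
Proof.
have /mapP[k Hk ->] : `|v ord0 j| \in [seq `|v x.1 x.2| | x : 'I_1 * 'I_m].
  by apply/mapP; exists (ord0, j) => //=; rewrite mem_enum.
by rewrite [leRHS]/Num.norm /= mx_normrE; apply/bigmax_geP; right => /=; exists k.
Qed.

(** [z] lies between [z + v] and the point at distance 1 in the opposite direction, where [f] is
    bounded below; concavity then bounds [f (z + v)] above. *)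
Lemma concave_linear_ub (f : 'rV[R]_m -> R) z : concave_fun f ->
  exists2 B, 0 <= B & forall v, f (z + v) <= f z + B * `|v|.
Proof.
move=> fc; have [M HM] := concave_box_lb (index_enum 'I_m) (delta_mx ord0) fc z.
have {}HM v : `|v| <= 1 -> M <= f (z + v).
  move=> v1; rewrite [v in z + v]row_sum_delta; apply: HM => j.
  exact: le_trans (coord_le_norm v j) v1.
exists (f z - M).
  by have := HM 0; rewrite normr0 addr0 subr_ge0; apply; exact: ler01.
move=> v; have [->|vn0] := eqVneq v 0; first by rewrite addr0 normr0 mulr0 addr0.
have r0 : 0 < `|v| by rewrite normr_gt0.
set r := `|v| in r0 *.
have rn0 : r != 0 by rewrite gt_eqF.
have r1 : 0 < 1 + r by lra.
have rn1 : 1 + r != 0 by rewrite gt_eqF.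
have := HM (- (r^-1 *: v)).
rewrite normrN normrZ normfV normr_id mulVf// => /(_ (lexx _)) Mle.
have := fc _ _ (z - r^-1 *: v) (z + v) (divr_ge0 (ltW r0) (ltW r1))
  (divr_ge0 ler01 (ltW r1)) ltac:(field; exact rn1).
have -> : r / (1 + r) *: (z - r^-1 *: v) + 1 / (1 + r) *: (z + v) = z.
  by apply/rowP => k; rewrite !mxE; field; rewrite rn0 rn1.
move=> /(ler_wpM2l (ltW r1)).
have -> : (1 + r) * (r / (1 + r) * f (z - r^-1 *: v) + 1 / (1 + r) * f (z + v)) =
   r * f (z - r^-1 *: v) + f (z + v) by field.
have := ler_wpM2l (ltW r0) Mle; lra.
Qed.

Lemma is_norm_le nrm : is_norm nrm ->
  exists2 B, 0 <= B & forall v, nrm v <= B * `|v|.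
Proof.
move=> [n0 _ nZ nD]; exists (\sum_j nrm (delta_mx ord0 j)); first exact: sumr_ge0.
move=> v; rewrite {1}(row_sum_delta v) mulr_suml.
have nrm0 : nrm 0 = 0 by rewrite -(scale0r (0 : 'rV[R]_m)) nZ normr0 mul0r.
apply: (@le_trans _ _ (\sum_j nrm (v ord0 j *: delta_mx ord0 j))).
  apply: (big_ind2 (fun x y => nrm x <= y)) => //; first by rewrite nrm0.
  by move=> x1 x2 y1 y2 h1 h2; apply: le_trans (nD _ _) _; apply: lerD.
apply: ler_sum => j _; rewrite nZ mulrC; apply: ler_wpM2l => //.
exact: coord_le_norm.
Qed.

Lemma is_norm_continuous nrm : is_norm nrm -> continuous nrm.
Proof.
move=> nP; have [B B0 HB] := is_norm_le nP; have [n0 _ nZ nD] := nP.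
have nN v : nrm (- v) = nrm v by rewrite -scaleN1r nZ normrN1 mul1r.
have lip v w : `|nrm v - nrm w| <= (B + 1) * `|v - w|.
  apply: (@le_trans _ _ (nrm (v - w))); last first.
    apply: le_trans (HB _) _; apply: ler_wpM2r; [exact: normr_ge0|lra].
  have := nD (v - w) w; have := nD (w - v) v; rewrite !subrK.
  have -> : nrm (w - v) = nrm (v - w) by rewrite -nN opprB.
  by rewrite ler_norml => *; apply/andP; split; lra.
have B1 : 0 < B + 1 by lra.
move=> v; apply/(@cvgrPdist_lt _ R^o _ (nbhs v) (nbhs_filter v)) => e e0; near=> w.
apply: le_lt_trans (lip _ _) _; rewrite mulrC -ltr_pdivlMr//.
near: w; exact: (nbhs_ball_norm v (PosNum (divr_gt0 e0 B1))).
Unshelve. all: by end_near. Qed.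

(** The minimum of [nrm] on the compact unit sphere is positive; its inverse is the constant. *)
Lemma norm_le_is_norm nrm : is_norm nrm ->
  exists2 c, 0 <= c & forall v, `|v| <= c * nrm v.
Proof.
move=> nP; have [n0 nz nZ nD] := nP.
pose S := [set v : 'rV[R]_m | `|v| = 1].
have unit v : v != 0 -> S (`|v|^-1 *: v).
  by move=> vn0; rewrite /S /= normrZ normfV normr_id mulVf// normr_eq0.
(* In dimension 0 the sphere is empty. *)
have [S0|/set0P S0] := eqVneq S set0.
  exists 0 => // v; have [->|vn0] := eqVneq v 0; first by rewrite normr0 mul0r.
  by have := unit _ vn0; rewrite S0.
have Scompact : compact S.
  apply: bounded_closed_compact.
    exists 1; split; first exact: num_real.
    by move=> x x1 v /= ->; exact: ltW.
  rewrite (_ : S = (fun v => `|v|) @^-1` [set 1]); last by [].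
  apply: closed_comp; last exact: closed_eq.
  by move=> v _; exact: norm_continuous.
have ncont : {within S, continuous nrm}.
  by apply: continuous_subspaceT => v; exact: is_norm_continuous.
have [w /set_mem Sw wmin] := EVT_min_rV S0 Scompact ncont.
have nw : 0 < nrm w.
  rewrite lt_neqAle n0 andbT eq_sym; apply/eqP => /nz w0.
  by move: Sw; rewrite /S /= w0 normr0 => /esym/eqP; rewrite oner_eq0.
exists (nrm w)^-1; first by rewrite invr_ge0 ltW.
move=> v; have [->|vn0] := eqVneq v 0; first by rewrite normr0 mulr_ge0// invr_ge0 ltW.
have v0 : 0 < `|v| by rewrite normr_gt0.
have := wmin _ (mem_set (unit _ vn0)).
rewrite nZ normfV normr_id mulrC ler_pdivlMr// => H.
by rewrite mulrC ler_pdivlMr// mulrC.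
Qed.

End RowVectors.

Section WorstCaseProfile.
Context (R : realType) (m : nat).
Variables (Z : set 'rV[R]_m) (c : 'rV[R]_m -> 'rV[R]_m -> R) (l : 'rV[R]_m -> R).
Variables (zh : 'rV[R]_m) (nrm : 'rV[R]_m -> R) (p : R).

Definition reachable (u : R) : set 'rV[R]_m :=
  [set v | Z (zh + v) /\ c (zh + v) zh <= u].

(** For [u >= 0] this real [sup] is genuine: the zero displacement is reachable and [profile_bnd]
    bounds the set. *)
Definition profile (u : R) : R := sup [set l (zh + v) | v in reachable u].

Hypotheses (tc : transport_cost Z c) (Zzh : Z zh).
Hypothesis Zconvex : @convex_set R 'rV[R]_m Z.
Hypothesis lconc : concave_fun l.
Hypotheses (nP : is_norm nrm) (p1 : 1 <= p).
Hypothesis cost_ge : forall z z', Z z -> Z z' -> nrm (z - z') `^ p <= c z z'.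

Lemma reachable0 u : 0 <= u -> reachable u 0.
Proof. by move=> u0; rewrite /reachable /= addr0 (cost_diag tc). Qed.

Lemma reachable_norm u v : reachable u v -> nrm v <= u `^ p^-1.
Proof.
move=> [Zv cu]; have p1' := p1; have [n0 _ _ _] := nP.
have := le_trans (cost_ge Zv Zzh) cu; rewrite addrC addKr => H.
have np0 : 0 <= nrm v `^ p by exact: powR_ge0.
have -> : nrm v = (nrm v `^ p) `^ p^-1.
  by rewrite -powRrM divff ?powRr1// gt_eqF//; lra.
by apply: ge0_ler_powR => //; rewrite ?nnegrE ?invr_ge0; lra.
Qed.

Lemma reachable_conv s t u u' v v' : 0 <= s -> 0 <= t -> s + t = 1 ->
  reachable u v -> reachable u' v' -> reachable (s * u + t * u') (s *: v + t *: v').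
Proof.
move=> s0 t0 st [Zv cv] [Zv' cv'].
have s1 : s <= 1 by lra.
have tE : t = 1 - s by lra.
have E : zh + (s *: v + t *: v') = s *: (zh + v) + (1 - s) *: (zh + v').
  by rewrite tE; apply/rowP => k; rewrite !mxE; ring.
rewrite /reachable /= E; split.
  exact: set_mem (Zconvex (Itv01 s0 s1) (mem_set Zv) (mem_set Zv')).
have := cost_convex tc Zzh (Itv01 s0 s1) (mem_set Zv) (mem_set Zv') => H.
have {}H : c (s *: (zh + v) + (1 - s) *: (zh + v')) zh <=
    s * c (zh + v) zh + (1 - s) * c (zh + v') zh by exact: H.
apply: le_trans H _; rewrite -tE; apply: lerD; exact: ler_wpM2l.
Qed.

Lemma loss_linear_ub : exists2 B, 0 <= B &
  forall v, l (zh + v) <= l zh + B * nrm v.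
Proof.
have [B1 B10 H1] := concave_linear_ub zh lconc.
have [B2 B20 H2] := norm_le_is_norm nP.
exists (B1 * B2); first exact: mulr_ge0.
move=> v; apply: le_trans (H1 v) _; rewrite lerD2l -mulrA.
exact: ler_wpM2l.
Qed.

Let profile_bnd : exists2 B, 0 <= B &
  forall u v, reachable u v -> l (zh + v) <= l zh + B * u `^ p^-1.
Proof.
have [B B0 HB] := loss_linear_ub; exists B => // u v /reachable_norm uv.
by apply: le_trans (HB v) _; rewrite lerD2l; exact: ler_wpM2l.
Qed.

Lemma profile_ge u v : reachable u v -> l (zh + v) <= profile u.
Proof.
move=> uv; apply: ub_le_sup; last by exists v.
have [B B0 HB] := profile_bnd.
by exists (l zh + B * u `^ p^-1) => _ [w uw <-]; exact: HB.
Qed.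

Lemma profile_le u y : 0 <= u ->
  (forall v, reachable u v -> l (zh + v) <= y) -> profile u <= y.
Proof.
move=> u0 H; apply: ge_sup; last by move=> _ [v /H + <-].
by exists (l (zh + 0)), 0 => //; exact: reachable0.
Qed.

Lemma profile_concave : concave_profile profile.
Proof.
split.
  move=> u v u0 uv; apply: profile_le => // w [Zw cw]; apply: profile_ge.
  by split => //; exact: le_trans uv.
have ne u : 0 <= u -> [set l (zh + v) | v in reachable u] !=set0.
  by move=> u0; exists (l (zh + 0)), 0 => //; exact: reachable0.
move=> s t u u' s0 t0 st u0 u'0.
apply: sup_scale_le => //; first exact: ne.
move=> _ [v uv <-]; rewrite addrC; apply: sup_scale_le => //; first exact: ne.
move=> _ [v' uv' <-]; rewrite addrC.
apply: le_trans (lconc _ _ s0 t0 st) _.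
have tE : t = 1 - s by lra.
have -> : s *: (zh + v) + t *: (zh + v') = zh + (s *: v + t *: v').
  by rewrite tE; apply/rowP => k; rewrite !mxE; ring.
by apply: profile_ge; exact: reachable_conv.
Qed.

Lemma profile_growth_power : exists2 B, 0 <= B &
  forall u, 0 <= u -> profile u - profile 0 <= B * u `^ p^-1.
Proof.
have [B B0 HB] := profile_bnd; exists B => // u u0.
have := profile_ge (reachable0 (lexx 0)); rewrite addr0 => h0.
suff : profile u <= l zh + B * u `^ p^-1 by lra.
by apply: profile_le => // v /HB.
Qed.

Lemma profile_growth_sublinear (g r : R) (zh0 : 'rV[R]_m) : p = 1 -> 0 < g ->
  0 <= r < 1 -> (forall z, Z z -> l z <= g * (1 + nrm (z - zh0) `^ r)) ->
  exists2 B, 0 <= B & forall u, 0 <= u -> profile u - profile 0 <= B * (1 + u `^ r).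
Proof.
move=> pE g0 /andP[r0 r1] Hg; have [n0 _ _ nD] := nP.
set q := nrm (zh - zh0); have q0 : 0 <= q by exact: n0.
(* The growth bound is absolute while increments are relative to [l zh], which may be negative;
   hence the last summand. *)
exists (g + 2 * (g * (1 + q)) + `|l zh|).
  have := normr_ge0 (l zh); have : 0 <= g * (1 + q) by rewrite mulr_ge0 ?ltW//; lra.
  by lra.
move=> u u0.
have := profile_ge (reachable0 (lexx 0)); rewrite addr0 => h0.
suff : profile u <= l zh + (g + 2 * (g * (1 + q)) + `|l zh|) * (1 + u `^ r) by lra.
apply: profile_le => // v uv.
apply: le_trans (Hg _ (proj1 uv)) _.
have := reachable_norm uv; rewrite pE invr1 powRr1// => nv.
have nle : nrm (zh + v - zh0) <= (1 + q) * (1 + u).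
  have -> : zh + v - zh0 = (zh - zh0) + v by rewrite addrAC.
  apply: le_trans (nD _ _) _; rewrite -/q.
  have := mulr_ge0 q0 u0; lra.
(* (1 + q)^r <= 1 + q, and 1 + u is at most 2 or at most 2 u, according to whether u <= 1. *)
have P1 : nrm (zh + v - zh0) `^ r <= (1 + q) * (2 * (1 + u `^ r)).
  apply: (@le_trans _ _ (((1 + q) * (1 + u)) `^ r)).
    by apply: ge0_ler_powR; rewrite ?nnegrE ?mulr_ge0//; lra.
  rewrite powRM; [|lra|lra]; apply: ler_pM; rewrite ?powR_ge0//.
    by apply: ler1_powR; lra.
  have [u1|u1] := leP u 1.
    apply: (@le_trans _ _ (2 `^ r)); last first.
      have : 2 `^ r <= (2 : R) by apply: ler1_powR; lra.
      have := powR_ge0 u r; lra.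
    by apply: ge0_ler_powR; rewrite ?nnegrE; lra.
  apply: (@le_trans _ _ ((2 * u) `^ r)).
    by apply: ge0_ler_powR; rewrite ?nnegrE; lra.
  rewrite powRM//; have t2 : 2 `^ r <= (2 : R) by apply: ler1_powR; lra.
  by have := ler_wpM2r (powR_ge0 u r) t2; lra.
have un := powR_ge0 u r; have := ler_norm (- l zh); rewrite normrN => ln.
have := normr_ge0 (l zh) => l0.
have := mulr_ge0 l0 un; have := mulr_ge0 (ltW g0) un.
have := ler_wpM2l (ltW g0) P1.
lra.
Qed.

End WorstCaseProfile.

(** * Time bound and conclusion *)

Section TimeBound.
Context (R : realType).

Definition golden_rate : R := - ln (phi R).

Local Notation kappa := golden_rate.

Lemma golden_rate_gt0 : 0 < kappa.
Proof.
have /andP[p1 p2] := phi_bounds R.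
by rewrite /golden_rate oppr_gt0 ln_lt0//; apply/andP; split; lra.
Qed.

Lemma iteration_count (D eta : R) : 1 <= D -> 0 < eta -> exists2 n : nat,
  D * phi R ^+ n <= eta & n%:R <= `|ln D - ln eta| / kappa + 1.
Proof.
move=> D1 eta0.
have D0 : 0 < D by lra.
have /andP[p1 _] := phi_bounds R.
have ph0 : 0 < phi R by lra.
have kappa_gt0 := golden_rate_gt0.
have x0 : 0 <= `|ln D - ln eta| / kappa by rewrite divr_ge0// ltW.
have /andP[n1 n2] := truncn_itv x0.
exists (Num.truncn (`|ln D - ln eta| / kappa)).+1; last first.
  by rewrite -addn1 natrD lerD2r.
set n := _.+1 in n2 *.
rewrite -ler_ln ?posrE ?mulr_gt0 ?exprn_gt0//.
rewrite lnM ?posrE ?exprn_gt0// lnXn//.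
have : ln D - ln eta <= n%:R * kappa.
  rewrite -ler_pdivrMr//; apply: le_trans (ltW n2).
  by apply: ler_wpM2r; [rewrite invr_ge0 ltW|exact: ler_norm].
by rewrite /golden_rate -mulr_natl; lra.
Qed.

(** The summands absorb, in this order, ln D / kappa, ln (1 / eta) / kappa and the constant 2 from
    rounding and the extra round. *)
Definition time_const : R :=
  let g := ln 2 in (g^-1 / kappa + kappa^-1 + 2 / g).

Lemma iteration_count_log (D eta : R) (n : nat) : 1 <= D -> 0 < eta -> eta <= 2^-1 ->
  n%:R <= `|ln D - ln eta| / kappa + 1 ->
  n.+1%:R <= time_const * (ln eta^-1 * (1 + ln D)).
Proof.
move=> D1 eta0 eta2 nle; rewrite lnV ?posrE//.
have g0 : 0 < ln 2 :> R by rewrite ln_gt0//; lra.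
have lD : 0 <= ln D by apply: ln_ge0.
have lg : ln 2 <= - ln eta.
  rewrite -lnV ?posrE//; rewrite ler_ln ?posrE ?invr_gt0//.
  by rewrite -[2]invrK lef_pV2 ?posrE ?invr_gt0.
set g := ln 2 in g0 lg *; set l := - ln eta in lg *.
have nlD : `|ln D - ln eta| = ln D + l by rewrite ger0_norm// -/l; lra.
rewrite nlD in nle.
have ki : 0 < kappa^-1 by rewrite invr_gt0 golden_rate_gt0.
have gi : 0 < g^-1 by rewrite invr_gt0.
have l1 : 1 <= g^-1 * l by rewrite mulrC ler_pdivlMr// mul1r.
have -> : n.+1%:R = n%:R + 1 :> R by rewrite -addn1 natrD.
rewrite /time_const -/g.
have t1 : ln D / kappa <= g^-1 / kappa * (l * ln D).
  have := ler_wpM2r (mulr_ge0 lD (ltW ki)) l1; lra.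
have t2 : 2 <= 2 / g * l by lra.
have gk : 0 <= g^-1 / kappa by rewrite mulr_ge0// ltW.
have l0 : 0 <= l by lra.
have gl : 0 <= g^-1 * l by lra.
have kl := mulr_ge0 (ltW ki) l0.
have c1 := mulr_ge0 gk l0.
have c2 := mulr_ge0 kl lD.
have c3 := mulr_ge0 gl lD.
lra.
Qed.

(** 60 = 4 * 15: at most 15 for a pair evaluation in units of n.+1^2 cost, and at most 4 n.+1 local
    evaluations. Positive [cost] absorbs the bookkeeping ticks. *)
Lemma budget_time (K n cost t : nat) : (0 < cost)%N -> (0 < K)%N ->
  let Tpair := (n.+1 * (2 * (n.+1 * (2 * (2 * cost) + 2)) + 2))%N in
  let Tlocal := (K ^ 2 * Tpair.+1)%N in
  (t <= 1 + (Tlocal + (Tlocal + (n * Tlocal.+1 + Tlocal))))%N ->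
  (t <= 60 * (K ^ 2 * cost * n.+1 ^ 3))%N.
Proof.
move=> c0 K0 Tpair Tlocal tle.
have Tp : (Tpair.+1 <= 15 * (n.+1 ^ 2 * cost))%N by rewrite /Tpair; nia.
have Tl : (Tlocal <= K ^ 2 * (15 * (n.+1 ^ 2 * cost)))%N by rewrite leq_mul2l Tp orbT.
have Tl1 : (0 < Tlocal)%N by rewrite muln_gt0 expn_gt0 K0.
clearbody Tlocal.
have tl : (t <= n.+1 * (4 * Tlocal))%N by nia.
apply: leq_trans tl _; apply: leq_trans (leq_mul (leqnn _) (leq_mul (leqnn 4) Tl)) _.
by rewrite [(n.+1 ^ 3)%N]expnS; apply/eqP/eqnP; lia.
Qed.

End TimeBound.

(** For p > 1 both growth exponents are 1 / p; for p = 1 they are 1 and r. *)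
Lemma error_exponent_bounds (R : realType) (n m K N : nat) X Z c ell zhat rho nrm p
    (x : 'rV[R]_n) a (i : 'I_N) (k : 'I_K) :
  @transport_cost R m Z c -> (forall j, Z (zhat j)) ->
  @regularity R n m K N X Z c ell zhat rho nrm p ->
  error_exponent Z ell nrm p x a -> forall D, 1 <= D ->
  exists C, holder_profile (profile Z c (ell k x) (zhat i)) C D a.
Proof.
move=> tc Zz reg ea D D1.
have [_ _ Zc] := reg_Z reg.
have lc := concave_funP (reg_concave reg k x).
have hP := profile_concave tc (Zz i) Zc lc (reg_norm reg) (reg_p reg) (reg_cost reg).
have [B B0 HB] := profile_growth_power tc (Zz i) lc (reg_norm reg) (reg_p reg) (reg_cost reg).
have p1 := reg_p reg.
case: ea => [[p1' aE]|[pE [g [zh0 [r [[g0 Zzh0 r01 Hg] aE]]]]]].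
  have pi0 : 0 < p^-1 by rewrite invr_gt0; lra.
  have pi1 : p^-1 < 1 by rewrite invf_lt1; lra.
  have a0 : 0 < a by rewrite aE lt_min pi0 subr_gt0 pi1.
  have a1 : a <= p^-1 by rewrite aE ge_min lexx.
  have a2 : a <= 1 - p^-1 by rewrite aE ge_min lexx orbT.
  eexists; apply: (holder_profileP hP B0 a0 a1 (ltW pi1) (ltW pi0) a2 D1 HB).
  move=> u /HB /le_trans; apply; apply: ler_wpM2l => //.
  by rewrite lerDr.
have [B2 B20 HB2] : exists2 B, 0 <= B & forall u, 0 <= u ->
    profile Z c (ell k x) (zhat i) u - profile Z c (ell k x) (zhat i) 0
      <= B * (1 + u `^ r).
  apply: (profile_growth_sublinear tc (Zz i) lc (reg_norm reg) p1 (reg_cost reg) pE g0 r01).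
  move=> z Zz'; apply: le_trans (Hg z Zz'); apply: ub_le_sup; last by exists k.
  exists (\sum_j `|ell j x z|) => _ [j _ <-].
  rewrite (bigD1 j)//=; apply: le_trans (ler_norm _) _.
  by rewrite lerDl sumr_ge0.
move: r01 => /andP[r0 r1].
have a0 : 0 < a by lra.
have a1 : a <= p^-1 by rewrite pE invr1; lra.
have i1 : p^-1 <= 1 by rewrite pE invr1.
have a2 : a <= 1 - r by lra.
have B12 : 0 <= B + B2 by lra.
eexists; apply: (holder_profileP hP B12 a0 a1 i1 r0 a2 D1).
  move=> u u0; apply: le_trans (HB u u0) _.
  by apply: ler_wpM2r; [exact: powR_ge0|lra].
move=> u u0; apply: le_trans (HB2 u u0) _.
by apply: ler_wpM2r; [have := powR_ge0 u r; lra|lra].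
Qed.

(** This direction suffices, since the error estimate already compares computed values with
    [value]. *)
Lemma utility_le_value (R : realType) (m K : nat) Z c (lk : 'I_K -> 'rV[R]_m -> R)
    zh nrm p C D a b :
  transport_cost Z c -> Z zh -> (forall k, concave_fun (lk k)) ->
  is_norm nrm -> 1 <= p -> (forall z z', Z z -> Z z' -> nrm (z - z') `^ p <= c z z') ->
  0 <= C -> 0 < a -> (forall k, holder_profile (profile Z c (lk k) zh) C D a) ->
  b <= D ->
  (utility Z c lk zh b <= (value (fun k => profile Z c (lk k) zh) b)%:E)%E.
Proof.
move=> tc Zzh lc nP p1 cg C0 a0 hH bD.
apply: ge_ereal_sup => _ [[k1 k2] k12 <-].
apply: ge_ereal_sup => y [a1 [a2 [b1 [b2 [v1 [v2]]]]]].
move=> [[a10 a20 b10 b20] [Z1 Z2] [c1 c2] [a12 b12] ->].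
have perspP k al be v : 0 <= al -> Z (zh + v) -> al * c (zh + v) zh <= be ->
    al * lk k (zh + v) <= persp (profile Z c (lk k) zh) al be.
  move=> al0 Zv cv; have [->|aln0] := eqVneq al 0; first by rewrite persp0 mul0r.
  have alp : 0 < al by rewrite lt_neqAle eq_sym aln0.
  apply: ler_wpM2l => //; apply: (profile_ge Zzh (lc k) nP p1 cg).
  by split => //; rewrite ler_pdivlMr// mulrC.
rewrite lee_fin; apply: (@le_trans _ _ (mixture (profile Z c (lk k1) zh)
   (profile Z c (lk k2) zh) b a1 b1)).
  have -> : a2 = 1 - a1 by lra.
  rewrite /mixture; have -> : b - b1 = b2 by lra.
  apply: lerD; first exact: perspP.
  by apply: perspP => //; [lra|move: c2; have -> : a2 = 1 - a1 by lra].
apply: (value_ge C0 a0 hH bD).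
by exists k1, k2, a1, b1; split => //; apply/andP; split; lra.
Qed.

Theorem lemma4 (R : realType) :
  exists (Ctime : R) (d : nat),
  forall (n m K N : nat) (X : set 'rV[R]_n) (Z : set 'rV[R]_m)
    (c : 'rV[R]_m -> 'rV[R]_m -> R)
    (ell : 'I_K -> 'rV[R]_n -> 'rV[R]_m -> R)
    (zhat : 'I_N -> 'rV[R]_m) (rho : R) (nrm : 'rV[R]_m -> R) (p : R),
  transport_cost Z c -> (forall j, Z (zhat j)) -> 0 < rho ->
  regularity X Z c ell zhat rho nrm p ->
  forall (x : 'rV[R]_n) (i : 'I_N) (lambda : R), X x -> 0 <= lambda ->
  forall a : R, error_exponent Z ell nrm p x a ->
  exists Cerr : R,
  forall (WCO : oracle R m K) (Cost : 'I_K -> R -> nat) (Costmax : R -> nat),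
  oracle_assumption Z c (fun k z => ell k x z) WCO Cost ->
  (forall k (eps : R), 0 < eps -> (Cost k eps <= Costmax eps)%N) ->
  forall eps eta : R, 0 < eps -> 0 < eta ->
  exists (bhat : R) (out : local_output R m K) (t : nat),
    let Vhat := out.1.1 in
    [/\ budget_eval zhat rho WCO eps eta i lambda = Some ((bhat, out), t),
        (ereal_sup [set utility Z c (fun k z => ell k x z) (zhat i) b
                        - (lambda * b)%:E
                   | b in [set b : R | 0 <= b <= N%:R * rho]%R]
           - (Vhat - lambda * bhat)%:E
         <= (Cerr * (eps + eta `^ a))%:E)%E
      & eta <= 2^-1 ->
        t%:R <= Ctime * K%:R ^+ 2 * (Costmax eps)%:R * ln (eta^-1) ^+ 3
                * (1 + ln (1 + N%:R * rho)) ^+ d].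
Proof.
(* Three nested searches: the iteration count enters cubed, and with it the suppressed factor 1 + ln
   (1 + N rho). *)
exists (60 * time_const R ^+ 3), 3%N.
move=> n m K N X Z c ell zhat rho nrm p tc Zz rho0 reg x i lambda Xx lambda0 a ea.
have [_ _ Zc] := reg_Z reg.
have lc k := concave_funP (reg_concave reg k x).
have p1 := reg_p reg; have K2 := reg_K reg.
have N0 : 0 < N%:R :> R by rewrite ltr0n; case: (i) => j; exact: leq_ltn_trans.
set W := N%:R * rho; have W0 : 0 < W by rewrite mulr_gt0.
(* One bound for the initial widths of all three searches: budgets up to [W] and weights up to 1. *)
set D := 1 + W.
have D1 : 1 <= D by rewrite /D; lra.
have WD : W <= D by rewrite /D; lra.
pose h k := profile Z c (ell k x) (zhat i).
have hP k : concave_profile (h k).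
  exact: (profile_concave tc (Zz i) Zc (lc k) (reg_norm reg) p1 (reg_cost reg)).
have /choice [Ck HC] : forall k, exists C, holder_profile (h k) C D a.
  by move=> k; exact: (error_exponent_bounds i k tc Zz reg ea D1).
pose C : R := \sum_k `|Ck k|.
have C0 : 0 <= C by exact: sumr_ge0.
have hH k : holder_profile (h k) C D a.
  apply: holder_profile_le (HC k); apply: le_trans (ler_norm _) _.
  by rewrite /C (bigD1 k)//= lerDl sumr_ge0.
have a0 : 0 < a.
  case: ea => [[p1' ->]|[_ [g [zh0 [r [[_ _ /andP[_ r1] _] ->]]]]]]; last lra.
  by rewrite lt_min invr_gt0 subr_gt0 invf_lt1; [apply/andP; split|]; lra.
exists (36 + 24 * C) => WCO Cost Costmax oa cm eps eta eps0 eta0.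
have oracleP k u : 0 <= u -> exists L v t,
    [/\ WCO eps k (zhat i) u = ((L, v), t), (0 < t <= Costmax eps)%N &
        h k u - eps <= L <= h k u].
  move=> u0; have := oa eps k (zhat i) u eps0 (Zz i) u0.
  case: (WCO eps k (zhat i) u) => [[L v] t] [Zv cv LE wc /andP[t0 tc']].
  exists L, v, t; split => //.
    by rewrite t0 (leq_trans tc')// cm.
  apply/andP; split; last first.
    by rewrite LE; apply: (profile_ge (Zz i) (lc k) (reg_norm reg) p1 (reg_cost reg)).
  rewrite lerBlDr; apply: (profile_le tc (Zz i)) => // v' v'u.
  rewrite -lerBlDr -lee_fin EFinB; apply: le_trans wc.
  by apply: leeB => //; apply: ereal_sup_ubound; exists v'.
(* A single call at radius 0 already takes time. *)
have cost0 : (0 < Costmax eps)%N.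
  have [L [v [t [_ /andP[t0 tm] _]]]] := oracleP (Ordinal K2) 0 (lexx 0).
  exact: leq_trans tm.
have oracleP' k u : 0 <= u -> exists L v t,
    [/\ WCO eps k (zhat i) u = ((L, v), t), (t <= Costmax eps)%N &
        h k u - eps <= L <= h k u].
  by move=> /(oracleP k) [L [v [t [E /andP[_ tm] V]]]]; exists L, v, t.
have [nn nP nle] := iteration_count D1 eta0.
have [bhat [out [t [E tT err]]]] :=
  budget_correct (zhat := zhat) (rho := rho) (i := i) (WCO := WCO)
    K2 C0 D1 a0 eps0 eta0 hP hH oracleP' nP W0 WD lambda0.
exists bhat, out, t; split => //.
- rewrite leeBlDr// -EFinD; apply: ge_ereal_sup => y [b bI <-].
  rewrite leeBlDr// -EFinD.
  have /andP[b0 bW] := bI.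
  apply: le_trans (utility_le_value tc (Zz i) lc (reg_norm reg) p1 (reg_cost reg)
    C0 a0 hH (le_trans bW WD)) _.
  rewrite lee_fin; have := err b bI.
  have := mulr_ge0 C0 (ltW eps0); have := powR_ge0 eta a; rewrite -/h; lra.
move=> eta2.
have := budget_time cost0 (ltnW K2) tT.
rewrite -(ler_nat R) (natrM _ 60) (natrM _ (K ^ 2 * _)) (natrM _ (K ^ 2)) !natrX.
move=> /le_trans; apply.
have := iteration_count_log D1 eta0 eta2 nle.
set q := (X in _ <= _ * X) => nq.
have n0 : 0 <= nn.+1%:R :> R by exact: ler0n.
have : nn.+1%:R ^+ 3 <= (time_const R * q) ^+ 3.
  by apply: lerXn2r; rewrite ?nnegrE// (le_trans n0 nq).
rewrite exprMn => n3.
have -> : 60 * time_const R ^+ 3 * K%:R ^+ 2 * (Costmax eps)%:R * ln eta^-1 ^+ 3 *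
  (1 + ln D) ^+ 3 = 60 * (K%:R ^+ 2 * (Costmax eps)%:R * (time_const R ^+ 3 * q ^+ 3)).
  by rewrite /q exprMn; ring.
by apply: ler_wpM2l => //; apply: ler_wpM2l.
Qed.
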